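(* As $n\to\infty$, $$f(n, 8, 26) = \frac{9}{22}\, n^2 +o(n^2) \quad\text{and}\quad f(n, 10, 42) = \frac{5}{12}\,n^2+o(n^2).$$
   Context: For integers $p\ge 3$ and $2\le q\le \binom p2$, a $(p,q)$-coloring of the complete graph $K_n$ is a coloring of the edges of $K_n$ (not necessarily proper) such that every $p$-clique has at least $q$ distinct colors among its edges. The generalized Ramsey number $f(n,p,q)$ is the minimum number of colors for which $K_n$ has a $(p,q)$-coloring. *)

(* Defs.v *)
From mathcomp Require Import all_boot.

Set Implicit Arguments.
Unset Strict Implicit.
Unset Printing Implicit Defensive.

(* The edges of K_n, on the vertex set 'I_n. *)
Definition edge (n : nat) : finType := {e : {set 'I_n} | #|e| == 2}.

Definition clique_colors (n k : nat) (c : {ffun edge n -> 'I_k})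
    (S : {set 'I_n}) : {set 'I_k} :=
  [set c e | e : edge n & val e \subset S].

Definition pq_coloring (n p q k : nat) (c : {ffun edge n -> 'I_k}) : bool :=
  [forall S : {set 'I_n}, (#|S| == p) ==> (q <= #|clique_colors c S|)].

(* Some colors of the palette 'I_k may be unused; this does not affect the
   least k for which a coloring exists. *)
Definition has_pq_coloring (n p q k : nat) : bool :=
  [exists c : {ffun edge n -> 'I_k}, pq_coloring p q c].

(* The rainbow coloring is a (p, q)-coloring as soon as q <= 'C(p, 2). *)
Lemma ex_pq_coloring (n p q : nat) :
  q <= 'C(p, 2) -> exists k, has_pq_coloring n p q k.
Proof.
move=> le_q; exists #|{: edge n}|; apply/existsP.
exists [ffun e => enum_rank e]; apply/forallP => S; apply/implyP => /eqP cardS.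
apply: leq_trans le_q _; rewrite -cardS -cards_draws.
have -> : [set A : {set 'I_n} | A \subset S & #|A| == 2] =
          [set val e | e : edge n & val e \subset S].
  apply/setP => A; rewrite !inE; apply/andP/imsetP.
    case=> sAS A2; exists (Sub A A2 : edge n); last by rewrite SubK.
    by rewrite inE SubK.
  by case=> e; rewrite inE => se ->; split=> //; exact: (valP e).
rewrite card_imset; last exact: val_inj.
rewrite /clique_colors card_imset // => e1 e2; rewrite !ffunE.
exact: enum_rank_inj.
Qed.

Definition gen_ramsey (n p q : nat) (le_q : q <= 'C(p, 2)) : nat :=
  ex_minn (ex_pq_coloring n le_q).

(* Main.v *)
Require Import Defs.
From mathcomp Require Import all_boot all_order all_algebra.
From mathcomp Require Import zify ring lra.

(** Let a unit be a set of four vertices. A (p, q)-coloring with C(n, 2) - u colors yields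
    u units of which at most C(p, 2) - q lie in any p vertices: join every edge to a
    representative of its color (gen_ramsey_units). Conversely, u such units yield a
    coloring with C(n, 2) - u colors by merging two edges inside each unit, provided that
    all these edges can be chosen distinct (gen_ramsey_le_units). So one has to find the
    largest number of units no three of which fit in 8 vertices, for (p, q) = (8, 26), and
    the largest number of units no four of which fit in 10 vertices, for
    (p, q) = (10, 42). These two numbers are n^2 / 11 + o(n^2) and n^2 / 12 + o(n^2).

    Upper bounds on the number of units (sparse_3_8_bound, sparse_4_10_bound). Match
    units that share two vertices. In the first case a matched pair owns 11 pairs of
    vertices, apart from O(n) exceptions, and an unmatched unit owns 6; in the second
    case these numbers are 12 and 6, apart from O(1) units. Distinct matched pairs and
    unmatched units own disjoint sets of pairs, and there are C(n, 2) pairs in all.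

    Construction for (8, 26). Two units sharing two vertices form a hexagon: six
    vertices, the 11 pairs inside the units, and four further pairs, which are the
    sides of a rectangle. What is needed is a packing of hexagons that uses almost
    every pair of vertices exactly once as one of the 11, while the further pairs are
    confined to a set of o(n^2) pairs of vertices. The vertices are triples (x, z, y)
    with x and z vectors over F_23 and y an integer modulo q. A hexagon is the image of
    a fixed labelling under an affine map in each coordinate. Rectangle sides are the
    pairs that agree in y or in z, as for the sides of rectangles in a grid, and the
    first labels form a graceful labelling modulo 23 of the graph of the 11 pairs, so
    that a difference vector determines its hexagon (hexagon_point_adj).

    Construction for (10, 42). Four blocks of size 4 with pairwise intersections of
    size at most one fit in 10 vertices only if they form a quadrilateral: any two
    blocks meet, and no three have a common point. So it suffices to find
    quadrilateral-free partial Steiner systems covering almost all pairs. Take four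
    layers, each a copy of the integers modulo q, and all the blocks
    {(i, t_i a + b) : i = 0, ..., 3}. They cover every pair of points in distinct layers
    once, and generic slopes t_i exclude quadrilaterals of such lines (no_quad_lines).
    Inside each layer place a quadrilateral-free system on q points. A quadrilateral
    that uses blocks of both kinds has one block in a layer and three lines, and then
    three points of that block satisfy a fixed linear relation
    (no_quad_layer_lines). Each block contains such points for only boundedly many choices
    of the slopes, so by averaging a choice exists for which few blocks must be deleted
    (exists_slope). This divides the proportion of uncovered pairs by 4, up to o(1)
    (quad_free_deficit_step), and it can be repeated. *)

Set Implicit Arguments.
Unset Strict Implicit.
Unset Printing Implicit Defensive.

Import Order.TTheory GRing.Theory Num.Theory.

(** * Sparse families of units *)

Lemma double_bin2 n : 2 * 'C(n, 2) = n * n.-1.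
Proof. by rewrite -mul_bin_diag bin1. Qed.

Lemma exchange_card (I J : finType) (P : {pred I}) (R : {pred J}) (r : I -> J -> bool) :
  \sum_(i in P) #|[set j in R | r i j]| = \sum_(j in R) #|[set i in P | r i j]|.
Proof.
have eI i : #|[set j in R | r i j]| = \sum_(j in R) r i j.
  rewrite -sum1_card [RHS]big_mkcond [LHS]big_mkcond.
  by apply: eq_bigr => j _; rewrite inE; case: (j \in R) (r i j) => [] [].
have eJ j : #|[set i in P | r i j]| = \sum_(i in P) r i j.
  rewrite -sum1_card [RHS]big_mkcond [LHS]big_mkcond.
  by apply: eq_bigr => i _; rewrite inE; case: (i \in P) (r i j) => [] [].
by under eq_bigr do rewrite eI; rewrite exchange_big; apply: eq_bigr.
Qed.

Section SetCounting.

Variable T : finType.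
Implicit Types A B C W : {set T}.

(** The two-element subsets of [A]. *)
Definition pairs A : {set {set T}} := [set e : {set T} | e \subset A & #|e| == 2].

Lemma card_pairs A : #|pairs A| = 'C(#|A|, 2).
Proof. exact: cards_draws. Qed.

Lemma pairsI A B : pairs A :&: pairs B = pairs (A :&: B).
Proof. by apply/setP => e; rewrite !inE subsetI; do 2 case: (e \subset _); case: (_ == 2). Qed.

Lemma pairs_disjoint A B : #|A :&: B| <= 1 -> [disjoint pairs A & pairs B].
Proof.
by move=> le1; rewrite -setI_eq0 pairsI -cards_eq0 card_pairs bin_small.
Qed.

Lemma pairsS A B : A \subset B -> pairs A \subset pairs B.
Proof. by move=> sAB; apply/subsetP => e; rewrite !inE => /andP[/subset_trans-> //]. Qed.

Lemma sum_card_disjoint (I : finType) (P : {pred I}) (F : I -> {set T}) A :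
    {in P, forall i, F i \subset A} ->
    {in P &, forall i j, i != j -> [disjoint F i & F j]} ->
  \sum_(i in P) #|F i| <= #|A|.
Proof.
move=> sF dF.
have -> : \sum_(i in P) #|F i| = \sum_(x in A) #|[set i in P | x \in F i]|.
  rewrite -(@exchange_card _ _ P A (fun i x => x \in F i)).
  apply: eq_bigr => i iP; apply: eq_card => x; rewrite inE.
  by apply/idP/andP => [xF|[]] //; split=> //; exact: subsetP (sF i iP) x xF.
rewrite -sum1_card; apply: leq_sum => x _.
apply/card_le1P => i; rewrite inE => /andP[iP xi] j; rewrite !inE.
apply/idP/eqP => [/andP[jP xj]|->]; last by rewrite iP.
apply/eqP/negP => /negP neq; have := dF j i jP iP neq.
by move=> /disjointFr/(_ xj); rewrite xi.
Qed.

(** Two families whose members are pairwise disjoint, within and across. *)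
Lemma sum_card_disjoint2 (I J : finType) (P : {pred I}) (F : I -> {set T})
    (R : {pred J}) (G : J -> {set T}) A :
    {in P, forall i, F i \subset A} -> {in R, forall j, G j \subset A} ->
    {in P &, forall i i', i != i' -> [disjoint F i & F i']} ->
    {in R &, forall j j', j != j' -> [disjoint G j & G j']} ->
    {in P & R, forall i j, [disjoint F i & G j]} ->
  \sum_(i in P) #|F i| + \sum_(j in R) #|G j| <= #|A|.
Proof.
move=> sF sG dF dG dFG.
pose S := [pred x : I + J | match x with inl i => i \in P | inr j => j \in R end].
pose H x := match x with inl i => F i | inr j => G j end.
have := @sum_card_disjoint (I + J)%type S H A; rewrite big_sumType; apply.
  by case=> i iP; [exact: sF | exact: sG].
case=> i [] j iP jP // nij.
- by apply: dF => //; apply: contraNneq nij => ->.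
- exact: dFG.
- by rewrite disjoint_sym; exact: dFG.
- by apply: dG => //; apply: contraNneq nij => ->.
Qed.

End SetCounting.

Section Units.

Variables (T I : finType) (Q : I -> {set T}).
Implicit Types D J : {set I}.

(** The set of points covered by the units [Q i], [i] in [J]; distinct indices may
    carry the same set. *)
Definition hull J : {set T} := \bigcup_(i in J) Q i.

(** No [m] distinct units of [D] fit in [p] points: the Brown-Erdos-Sos condition. *)
Definition sparse (m p : nat) (D : {set I}) :=
  forall J, J \subset D -> #|J| = m -> p < #|hull J|.

Lemma hull2 i j : hull [set i; j] = Q i :|: Q j.
Proof.
rewrite /hull; case: (eqVneq i j) => [->|nij]; first by rewrite !setUid big_set1.
by rewrite big_setU1 ?inE // big_set1.
Qed.

Lemma hullU1 i J : hull (i |: J) = Q i :|: hull J.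
Proof. by rewrite /hull bigcup_setU big_set1. Qed.

(** A maximal matching of the graph [r] on [D], as a set of disjoint pairs of units:
    the unmatched units are pairwise non-adjacent. *)
Lemma max_matching (r : rel I) (D : {set I}) : symmetric r ->
  exists M : {set {set I}},
    [/\ trivIset M, cover M \subset D,
        forall m, m \in M -> exists i j, [/\ i != j, r i j & m = [set i; j]] &
        {in D :\: cover M &, forall i j, i != j -> ~~ r i j}].
Proof.
move=> rsym.
pose good (M : {set {set I}}) := [&& trivIset M, cover M \subset D &
  [forall m in M, [exists i, exists j, [&& i != j, r i j & m == [set i; j]]]]].
have g0 : good set0.
  apply/and3P; split; last by apply/forall_inP => m; rewrite inE.
    by apply/trivIsetP => A B; rewrite inE.
  by rewrite /cover big_set0 sub0set.
have [M /maxsetP[/and3P[tM cM /forall_inP gM] maxM] _] := maxset_exists g0.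
exists M; split=> //.
  move=> m /gM /existsP[i /existsP[j /and3P[? ? /eqP ->]]].
  by exists i, j.
move=> i j /setDP[iD iM] /setDP[jD jM] nij; apply/negP => rij.
have mem e : e \in [set i; j] -> e \notin cover M by rewrite !inE => /orP[]/eqP->.
have notM : [set i; j] \notin M.
  apply: contra iM => ijM; apply/bigcupP; exists [set i; j] => //.
  by rewrite !inE eqxx.
case/negP: notM; rewrite -(maxM ([set i; j] |: M)) ?setU11 ?subsetUr //.
have dis B : B \in M -> [disjoint [set i; j] & B].
  move=> BM; rewrite -setI_eq0; apply/eqP/setP => x; rewrite in_setI in_set0.
  apply/negP => /andP[/mem xM xB]; case/negP: xM.
  by apply/bigcupP; exists B.
apply/and3P; split.
- apply/trivIsetP => A B /setU1P[->|AM] /setU1P[->|BM]; rewrite ?eqxx // => nAB.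
  + exact: dis.
  + by rewrite disjoint_sym dis.
  + by move/trivIsetP: tM => /(_ A B AM BM nAB).
- by rewrite /cover bigcup_setU big_set1 subUset cM subUset !sub1set iD jD.
- apply/forall_inP => m /setU1P[->|/gM //].
  by apply/existsP; exists i; apply/existsP; exists j; rewrite nij rij eqxx.
Qed.

Lemma card_matching (M : {set {set I}}) (D : {set I}) :
    trivIset M -> cover M \subset D -> (forall m, m \in M -> #|m| = 2) ->
  #|D| = #|D :\: cover M| + 2 * #|M|.
Proof.
move=> tM cM M2; rewrite -(cardsID (cover M) D) addnC; congr (_ + _).
rewrite (setIidPr cM) -(eqP tM).
have -> : \sum_(B in M) #|B| = \sum_(B in M) 2 by apply: eq_bigr => B /M2.
by rewrite sum_nat_const mulnC.
Qed.


Lemma sparse3 p D i j k : sparse 3 p D -> i \in D -> j \in D -> k \in D ->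
  i != j -> k != i -> k != j -> p < #|Q i :|: Q j :|: Q k|.
Proof.
move=> sp iD jD kD nij nki nkj.
rewrite setUC -hull2 -hullU1; apply: sp; first by rewrite !subUset !sub1set iD jD kD.
by rewrite cardsU1 cards2 !inE nij negb_or nki nkj.
Qed.

Lemma sparse4 p D i j k l : sparse 4 p D ->
  i \in D -> j \in D -> k \in D -> l \in D ->
  i != j -> k != i -> k != j -> l != i -> l != j -> l != k ->
  p < #|Q i :|: Q j :|: Q k :|: Q l|.
Proof.
move=> sp iD jD kD lD nij nki nkj nli nlj nlk.
rewrite setUC [_ :|: Q k]setUC -hull2 -!hullU1; apply: sp.
  by rewrite !subUset !sub1set iD jD kD lD.
rewrite 2!cardsU1 cards2 !inE nij !negb_or nki nkj.
by rewrite nli nlj nlk.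
Qed.

End Units.

Section SparseBounds.

Variables (T I : finType) (Q : I -> {set T}).
Hypothesis card4 : forall i, #|Q i| = 4.

(** Match units sharing two points. A matched pair of units usually owns 11 pairs of
    points and an unmatched unit owns 6 > 11 / 2; the exceptional matched pairs
    (at most five points) are disjoint from all other units, so there are at most
    linearly many of them. *)
Lemma sparse_3_8_bound : sparse Q 3 8 setT -> 11 * #|I| <= #|T| ^ 2 + 3 * #|T|.
Proof.
move=> sp.
pose r i j := 1 < #|Q i :&: Q j|.
have [|M [tM cM gM nM]] := @max_matching _ r setT.
  by move=> i j; rewrite /r setIC.
have M2 m : m \in M -> #|m| = 2 by move=> /gM[i [j [nij _ ->]]]; rewrite cards2 nij.
have := card_matching tM cM M2; rewrite cardsT => cI.
set R := setT :\: cover M in nM cI *.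
pose O (x : {set I}) := \bigcup_(i in x) pairs (Q i).
(* [F x] is nonempty only for the exceptional pairs; it makes up for the missing
   pairs of points, since 6 + 2 * 4 and 9 + 2 * 5 are at least 11. *)
pose F (x : {set I}) := if #|hull Q x| <= 5 then hull Q x else set0.
(* A third unit meets a matched pair in at most one point. *)
have third m k : m \in M -> k \notin m -> #|Q k :&: hull Q m| + 5 <= #|hull Q m| <= 6.
  move=> /gM[i [j [nij rij ->]]]; rewrite !inE negb_or => /andP[nki nkj].
  rewrite hull2; have := sparse3 sp (in_setT i) (in_setT j) (in_setT k) nij.
  move=> /(_ nki nkj); rewrite setUC !cardsU !card4.
  by move: rij; rewrite /r; lia.
have notin m m' i : m \in M -> m' \in M -> m != m' -> i \in m -> i \notin m'.
  move=> mM m'M nm im; move/trivIsetP: tM => /(_ m m' mM m'M nm).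
  by move=> /disjointFr/(_ im) ->.
have share m i k : m \in M -> i \in m -> k \notin m -> #|Q i :&: Q k| <= 1.
  move=> mM im km; have /andP[h1 h2] := third m k mM km.
  have : Q i :&: Q k \subset Q k :&: hull Q m.
    by rewrite setIC setIS //; apply: bigcup_sup.
  by move/subset_leq_card; lia.
have OM m : m \in M -> 11 <= #|O m| + 2 * #|F m|.
  move=> mM; have [i [j [nij rij em]]] := gM m mM.
  rewrite /O /F em hull2 big_setU1 ?inE //= big_set1 !cardsU pairsI !card_pairs !card4.
  have : #|Q i :&: Q j| <= 4 by rewrite -(card4 i) subset_leq_card ?subsetIl.
  move: rij; rewrite /r; case Es: #|_| => [|[|[|[|[|s]]]]] //= _ _.
  - by rewrite cardsU !card4 Es.
  - by rewrite cardsU !card4 Es.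
have dO (x y : {set I}) : (forall i k, i \in x -> k \in y -> #|Q i :&: Q k| <= 1) ->
    [disjoint O x & O y].
  move=> xy; rewrite -setI_eq0; apply/eqP/setP => e; rewrite !inE.
  apply/negP => /andP[/bigcupP[i ix ei] /bigcupP[k ky ek]].
  by have /pairs_disjoint/disjointFr/(_ ei) := xy i k ix ky; rewrite ek.
have RM i m : i \in R -> m \in M -> i \notin m.
  move=> /setDP[_ iM] mM; apply: contra iM => im; apply/bigcupP.
  by exists m.
have le1 : \sum_(m in M) #|O m| + \sum_(i in R) #|pairs (Q i)| <= #|pairs [set: T]|.
  have sO (i : I) : pairs (Q i) \subset pairs [set: T] by rewrite pairsS.
  apply: sum_card_disjoint2 => [m _|i _||i k iR kR nik|m i mM iR].
  - by apply/bigcupsP => i _.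
  - by [].
  - move=> m m' mM m'M nm; apply: dO => i k im km'.
    by apply: share im _ => //; apply: notin km' => //; rewrite eq_sym.
  - by apply: pairs_disjoint; have := nM i k iR kR nik; rewrite /r -leqNgt.
  - have -> : pairs (Q i) = O [set i] by rewrite /O big_set1.
    apply: dO => j k jm.
    by rewrite inE => /eqP->; apply: share jm _ => //; apply: RM.
have le2 : \sum_(m in M) #|F m| <= #|[set: T]|.
  apply: sum_card_disjoint => [m _|m m' mM m'M nm]; first exact: subsetT.
  rewrite /F; case: ifP => [d|_]; last by rewrite -setI_eq0 set0I.
  case: ifP => [d'|_]; last by rewrite -setI_eq0 setI0.
  rewrite -setI_eq0; apply/eqP/setP => x; rewrite in_setI in_set0.
  apply/negP => /andP[xm /bigcupP[k km' xk]].
  have /third/(_ (notin _ _ _ _ _ _ km')) := mM; rewrite ![m' == _]eq_sym => /(_ m'M mM nm).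
  have : 0 < #|Q k :&: hull Q m| by apply/card_gt0P; exists x; rewrite inE xk.
  by clear -d; lia.
have le3 : \sum_(m in M) 11 <= \sum_(m in M) (#|O m| + 2 * #|F m|).
  by apply: leq_sum => m /OM.
have e6 : \sum_(i in R) #|pairs (Q i)| = \sum_(i in R) 6.
  by apply: eq_bigr => i _; rewrite card_pairs card4.
move: le1 le2 le3; rewrite e6 big_split /= -big_distrr /= !sum_nat_const.
rewrite card_pairs !cardsT; have := double_bin2 #|T|.
have -> : #|T| ^ 2 = #|T| * #|T|.-1 + #|T| by rewrite -mulnSr -mulnn; case: #|T|.
move: (#|T| * _) 'C(_, _) => t c; rewrite cI.
by move: (\sum_(m in M) #|O m|) (\sum_(m in M) #|F m|) #|R| #|M| #|T| => a b x y z; lia.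
Qed.


(** Up to finitely many units, two units share at most two points and three units
    span at least seven. Match units sharing two points: a matched pair spans six
    points, hence 15 pairs of points. At most one unmatched unit claims some of
    these, and then at most three; so 12 pairs remain for the two units, and 6 for
    each unmatched one. *)
Lemma sparse_4_10_bound : sparse Q 4 10 setT -> 12 * #|I| <= #|T| ^ 2 + 36.
Proof.
move=> sp.
have sp4 (i j k l : I) := sparse4 sp (in_setT i) (in_setT j) (in_setT k) (in_setT l).
(* Three units on at most six points leave no room for a fourth one. *)
have [|no6] := boolP [exists J : {set I}, (#|J| == 3) && (#|hull Q J| <= 6)].
  case/existsP => J /andP[/eqP J3 hJ]; suff : #|I| <= 3 by lia.
  rewrite -J3 -cardsT subset_leq_card //; apply/subsetP => i _; apply/negP => /negP iJ.
  have := sp (i |: J) (subsetT _); rewrite cardsU1 iJ J3 => /(_ erefl).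
  by rewrite hullU1 cardsU card4; lia.
have three i j k : i != j -> k != i -> k != j -> 6 < #|Q i :|: Q j :|: Q k|.
  move=> nij nki nkj; rewrite ltnNge; apply: contra no6 => le6.
  apply/existsP; exists (k |: [set i; j]); rewrite hullU1 hull2 [Q k :|: _]setUC le6 andbT.
  by rewrite cardsU1 cards2 !inE nij negb_or nki nkj.
(* Two disjoint pairs of units on five points each would span at most ten. *)
have [D cD share2] : exists2 D : {set I}, #|I| <= #|D| + 2 &
    {in D &, forall i j, i != j -> #|Q i :&: Q j| <= 2}.
  have [|none] := boolP [exists i, exists j, (i != j) && (2 < #|Q i :&: Q j|)].
    case/existsP => i /existsP[j /andP[nij gij]]; exists (~: [set i; j]).
      by rewrite addnC -(cardsC [set i; j]) cards2 nij.
    move=> k l; rewrite !inE !negb_or => /andP[ki kj] /andP[li lj] nkl.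
    have := sp4 i j; rewrite eq_sym in nkl.
    move=> /(_ k l nij ki kj li lj nkl); rewrite -setUA cardsU !(cardsU (Q _) (Q _)) !card4.
    lia.
  exists setT; first by rewrite cardsT leq_addr.
  move=> i j _ _ nij; rewrite leqNgt; apply: contra none => gij.
  by apply/existsP; exists i; apply/existsP; exists j; rewrite nij.
pose r i j := 1 < #|Q i :&: Q j|.
have [|M [tM cM gM nM]] := @max_matching _ r D.
  by move=> i j; rewrite /r setIC.
have M2 m : m \in M -> #|m| = 2 by move=> /gM[i [j [nij _ ->]]]; rewrite cards2 nij.
have cDM := card_matching tM cM M2.
set R := D :\: cover M in nM cDM.
have mD m i : m \in M -> i \in m -> i \in D.
  by move=> mM im; apply: (subsetP cM); apply/bigcupP; exists m.
have notin m m' i : m \in M -> m' \in M -> m != m' -> i \in m -> i \notin m'.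
  move=> mM m'M nm im; move/trivIsetP: tM => /(_ m m' mM m'M nm).
  by move=> /disjointFr/(_ im) ->.
have RM i m : i \in R -> m \in M -> i \notin m.
  move=> /setDP[_ iM] mM; apply: contra iM => im; apply/bigcupP.
  by exists m.
have W6 m : m \in M -> #|hull Q m| = 6.
  move=> mM; have [i [j [nij rij em]]] := gM m mM.
  have := share2 i j; rewrite !(mD m) // ?em ?inE ?eqxx ?orbT // => /(_ isT isT nij).
  by rewrite hull2 cardsU !card4; move: rij; rewrite /r; lia.
pose O m := pairs (hull Q m) :\: \bigcup_(k in R) pairs (Q k).
(* At most one unmatched unit shares two points with a given matched pair, and it
   shares at most three. *)
have O12 m : m \in M -> 12 <= #|O m|.
  move=> mM; rewrite /O cardsD card_pairs (W6 m mM) big_distrr /=.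
  have [i [j [nij rij em]]] := gM m mM.
  have le3 k : k \in R -> #|Q k :&: hull Q m| <= 3.
    move=> kR; have := RM k m kR mM; rewrite em !inE negb_or => /andP[ki kj].
    have := three i j k nij ki kj.
    rewrite -hull2 -em setUC cardsU card4 (W6 m mM).
    by clear; lia.
  have [/existsP[k /andP[kR gk]]|none] :=
      boolP [exists k, (k \in R) && (1 < #|Q k :&: hull Q m|)]; last first.
    rewrite big1 ?cards0 // => k kR; apply/eqP; rewrite setI_eq0 disjoint_sym.
    rewrite pairs_disjoint // leqNgt; apply: contra none => gk.
    by apply/existsP; exists k; rewrite kR.
  rewrite (big_setD1 k) //= [X in _ :|: X]big1 ?setU0 => [|l].
    rewrite pairsI card_pairs setIC; have := le3 k kR.
    by case: (#|_|) => [|[|[|[|]]]].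
  rewrite in_setD1 => /andP[nlk lR]; apply/eqP; rewrite setI_eq0 disjoint_sym.
  apply: pairs_disjoint; rewrite leqNgt; apply/negP => gl.
  have := RM k m kR mM; rewrite em !inE negb_or => /andP[ki kj].
  have := RM l m lR mM; rewrite em !inE negb_or => /andP[li lj].
  have := sp4 i j k l nij ki kj li lj nlk; rewrite -hull2 -em.
  have le8 : #|hull Q m :|: Q k| <= 8.
    by rewrite cardsU (W6 m mM) card4 [_ :&: Q k]setIC; clear -gk; lia.
  have ge2 : 1 < #|(hull Q m :|: Q k) :&: Q l|.
    by apply: leq_trans gl _; rewrite setIC subset_leq_card ?setSI ?subsetUl.
  by rewrite cardsU card4; clear -le8 ge2; lia.
have le1 : \sum_(m in M) #|O m| + \sum_(i in R) #|pairs (Q i)| <= #|pairs [set: T]|.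
  apply: sum_card_disjoint2 => [m _|i _|m m' mM m'M nm|i k iR kR nik|m i mM iR].
  - by apply: subset_trans (subsetDl _ _) _; rewrite pairsS.
  - by rewrite pairsS.
  - suff : [disjoint pairs (hull Q m) & pairs (hull Q m')].
      by rewrite -!setI_eq0 -!subset0; apply: subset_trans; apply: setISS; exact: subsetDl.
    apply: pairs_disjoint.
    have [i [j [nij rij em]]] := gM m mM; have [k [l [nkl rkl em']]] := gM m' m'M.
    have := notin m' m _ m'M mM; rewrite eq_sym => /(_ _ nm) nn.
    have := nn k; rewrite em' !inE eqxx em !inE negb_or => /(_ isT) /andP[ki kj].
    have := nn l; rewrite em' !inE eqxx orbT em !inE negb_or => /(_ isT) /andP[li lj].
    rewrite eq_sym in nkl; have := sp4 i j k l nij ki kj li lj nkl.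
    rewrite -setUA -[Q i :|: _]hull2 -[Q k :|: _]hull2 -em -em' cardsU.
    by rewrite (W6 m mM) (W6 m' m'M); clear; lia.
  - by apply: pairs_disjoint; have := nM i k iR kR nik; rewrite /r -leqNgt.
  - rewrite disjoint_sym disjoint_subset; apply/subsetP => e ei.
    by rewrite !inE negb_and negbK; apply/orP; left; apply/bigcupP; exists i.
have le3 : \sum_(m in M) 12 <= \sum_(m in M) #|O m| by apply: leq_sum => m /O12.
have e6 : \sum_(i in R) #|pairs (Q i)| = \sum_(i in R) 6.
  by apply: eq_bigr => i _; rewrite card_pairs card4.
move: le1 le3; rewrite e6 !sum_nat_const card_pairs !cardsT.
have := double_bin2 #|T|.
have -> : #|T| ^ 2 = #|T| * #|T|.-1 + #|T| by rewrite -mulnSr -mulnn; case: #|T|.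
move: (#|T| * _) 'C(_, _) cD; rewrite cDM => t c.
by move: (\sum_(m in M) #|O m|) #|R| #|M| #|I| => a x y z; lia.
Qed.

End SparseBounds.

(** * Colorings and units *)

Lemma exists_superset (T : finType) (A : {set T}) k : #|A| <= k <= #|T| ->
  exists2 B : {set T}, A \subset B & #|B| = k.
Proof.
case/andP=> Ak kT; pose l := take k (enum A ++ enum (~: A)).
have szl : size (enum A ++ enum (~: A)) = #|T| by rewrite size_cat -!cardE cardsC.
have ul : uniq (enum A ++ enum (~: A)).
  rewrite cat_uniq !enum_uniq andbT /=; apply/hasPn => x.
  by rewrite !mem_enum inE.
exists [set x in l].
  apply/subsetP => x xA; rewrite inE /l take_cat -cardE.
  by rewrite ltnNge Ak /= mem_cat mem_enum xA.
rewrite cardsE (card_uniqP (take_uniq _ ul)) size_takel // szl //.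
Qed.

Section ColoringsAndUnits.

Variable n : nat.
Implicit Types (S : {set 'I_n}) (e : edge n).

(** The edges of the clique on [S]. *)
Definition edges_in S : {set edge n} := [set e : edge n | val e \subset S].

Lemma card_edges_in S : #|edges_in S| = 'C(#|S|, 2).
Proof.
rewrite -card_pairs -(card_imset _ val_inj); congr #|pred_of_set _|.
apply/setP => A; rewrite !inE; apply/imsetP/andP => [[e]|[sAS A2]].
  by rewrite inE => se ->; split=> //; exact: (valP e).
by exists (Sub A A2 : edge n); rewrite ?inE SubK.
Qed.

Lemma card_edge : #|edge n| = 'C(n, 2).
Proof.
have := card_edges_in setT; rewrite cardsT card_ord => <-.
by apply: eq_card => e; rewrite !inE subsetT.
Qed.

(** A map [f] from edges to edges with values in [A] is a coloring with [#|A|] colors. *)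
Lemma gen_ramsey_le p q (le_q : q <= 'C(p, 2)) (A : {set edge n}) (f : edge n -> edge n) :
    (forall e, f e \in A) ->
    (forall S, #|S| = p -> q <= #|f @: edges_in S|) ->
  gen_ramsey n le_q <= #|A|.
Proof.
move=> fA fq; rewrite /gen_ramsey; case: ex_minnP => k _; apply.
have ltA e : index (f e) (enum A) < #|A| by rewrite cardE index_mem mem_enum fA.
apply/existsP; exists [ffun e => Ordinal (ltA e)].
apply/forallP => S; apply/implyP => /eqP /fq le; apply: leq_trans le _.
pose g (i : 'I_#|A|) := enum_val i.
rewrite (_ : f @: _ = g @: clique_colors [ffun e => Ordinal (ltA e)] S) ?leq_imset_card //.
rewrite /clique_colors -imset_comp; apply: eq_imset => e /=.
by rewrite ffunE /g (enum_val_nth (f e)) /= nth_index // mem_enum.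
Qed.

(** Give the two edges of each unit the same color, and every other edge its own
    color. A [p]-clique then misses one color per unit inside it. *)
Lemma gen_ramsey_le_units p q m (le_q : q <= 'C(p, 2)) (I : finType)
    (e1 e2 : I -> edge n) :
    injective e1 -> injective e2 -> (forall i j, e1 i != e2 j) ->
    sparse (fun i => val (e1 i) :|: val (e2 i)) m.+1 p setT -> q + m <= 'C(p, 2) ->
  gen_ramsey n le_q + #|I| <= 'C(n, 2).
Proof.
move=> inj1 inj2 ne12 sp qm.
pose f e := if [pick i | e == e2 i] is Some i then e1 i else e.
pose A := ~: [set e2 i | i in I].
have cA : #|A| + #|I| = 'C(n, 2).
  by rewrite -card_edge -(cardsC [set e2 i | i in I]) card_imset // addnC.
rewrite -cA leq_add2r; apply: (@gen_ramsey_le _ _ _ _ f).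
  move=> e; rewrite inE /f; case: pickP => [i _|none]; apply/imsetP => -[j _].
    by move/eqP; rewrite (negPf (ne12 _ _)).
  by move=> ee; have := none j; rewrite ee eqxx.
move=> S cS; pose K := [set i : I | (e1 i \in edges_in S) && (e2 i \in edges_in S)].
(* [K] consists of the units inside [S]. *)
have leK : #|K| <= m.
  rewrite leqNgt; apply/negP => mK.
  have [J sJ cJ] : exists2 J : {set I}, J \subset K & #|J| = m.+1.
    exists [set x in take m.+1 (enum K)].
      by apply/subsetP => x; rewrite inE => /mem_take; rewrite mem_enum.
    by rewrite cardsE (card_uniqP (take_uniq _ (enum_uniq _))) size_takel // -cardE.
  have := sp J (subsetT _) cJ; rewrite -cS ltnNge => /negP; apply.
  apply: subset_leq_card; apply/bigcupsP => i /(subsetP sJ).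
  by rewrite !inE subUset.
(* The merged colors of [S] remain distinct once the second edge of each unit
   inside [S] is dropped. *)
have injf : {in edges_in S :\: e2 @: K &, injective f}.
  have key e e' : e \in edges_in S :\: e2 @: K -> e' \in edges_in S ->
      [pick i | e' == e2 i] = None -> f e = f e' -> e = e'.
    rewrite /f => /setDP[eS eK] e'S -> ; case: pickP => // i /eqP ei e1e'.
    case/imsetP: eK; exists i => //; rewrite inE e1e' e'S.
    by rewrite -ei eS.
  move=> e e' eD e'D; case E: [pick i | e == e2 i] => [i|]; last first.
    by move=> fe; apply/esym/(key e' e) => //; case/setDP: eD.
  case E': [pick i | e' == e2 i] => [j|]; last by apply: key => //; case/setDP: e'D.
  rewrite /f E E' => /inj1 eij; move: E E'; rewrite eij.
  by case: pickP => // x /eqP-> [->]; case: pickP => // y /eqP-> [->].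
have : #|edges_in S :\: e2 @: K| <= #|f @: edges_in S|.
  by rewrite -(card_in_imset injf) subset_leq_card ?imsetS ?subsetDl.
apply: leq_trans; rewrite cardsD card_edges_in cS.
have : #|edges_in S :&: e2 @: K| <= m.
  by apply: leq_trans leK; rewrite (leq_trans (subset_leq_card (subsetIr _ _))) ?leq_imset_card.
by move: qm; clear; lia.
Qed.

(** Conversely, choose a representative edge in each color class of an optimal
    coloring. Every other edge, together with its representative, lies in a set of
    four points; these sets are the units, one for each color that is lost. *)
Lemma gen_ramsey_units p q (le_q : q <= 'C(p, 2)) : 4 <= p <= n ->
  exists (I : finType) (Q : I -> {set 'I_n}),
    [/\ forall i, #|Q i| = 4, sparse Q ('C(p, 2) - q).+1 p setT
      & 'C(n, 2) <= gen_ramsey n le_q + #|I|].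
Proof.
case/andP=> p4 pn; rewrite /gen_ramsey; case: ex_minnP => k /existsP[c /forallP pq] _.
pose rep e := odflt e [pick e' | c e' == c e].
have crep e : c (rep e) = c e by rewrite /rep; case: pickP => //= e' /eqP.
have reprep e e' : c e = c e' -> rep e = rep e'.
  rewrite /rep => ->; case: pickP => // /(_ e'); by rewrite eqxx.
pose I := {e : edge n | rep e != e}.
have exQ (i : I) : exists B : {set 'I_n},
    (val (val i) :|: val (rep (val i)) \subset B) && (#|B| == 4).
  have [|B sB cB] := @exists_superset _ (val (val i) :|: val (rep (val i))) 4.
    rewrite card_ord (leq_trans p4 pn) andbT; apply: leq_trans (leq_card_setU _ _) _.
    by rewrite (eqP (valP (val i))) (eqP (valP (rep (val i)))).
  by exists B; rewrite sB cB eqxx.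
pose Q i := xchoose (exQ i).
have /all_and2[sQ cQ] i : val (val i) :|: val (rep (val i)) \subset Q i /\ #|Q i| = 4.
  by have /andP[? /eqP] := xchooseP (exQ i).
exists I, Q; split=> //.
- move=> J _ cJ; rewrite ltnNge; apply/negP => le.
  have [|S sS cS] := @exists_superset _ (hull Q J) p; first by rewrite le card_ord.
  have := pq S; rewrite cS eqxx /= leqNgt => /negP; apply.
  pose J' := val @: J.
  have sJ' : J' \subset edges_in S.
    apply/subsetP => _ /imsetP[i iJ ->]; rewrite inE; apply: subset_trans sS.
    apply: subset_trans (bigcup_sup i iJ); apply: subset_trans (sQ i).
    exact: subsetUl.
  have cD : #|edges_in S :\: J'| = 'C(p, 2) - ('C(p, 2) - q).+1.
    by rewrite cardsD (setIidPr sJ') card_edges_in cS card_imset ?cJ //; exact: val_inj.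
  have posq : 'C(p, 2) - q < 'C(p, 2).
    have := subset_leq_card sJ'; rewrite card_imset; last exact: val_inj.
    by rewrite cJ card_edges_in cS.
  have sub : clique_colors c S \subset c @: (edges_in S :\: J').
    apply/subsetP => _ /imsetP[e eS ->]; have eS' : e \in edges_in S by [].
    have [eJ|eJ] := boolP (e \in J'); last by apply: imset_f; rewrite inE eJ.
    rewrite -crep; apply: imset_f; have [i iJ ei] := imsetP eJ.
    rewrite in_setD; apply/andP; split.
      apply/imsetP => -[j jJ ej]; have := valP j; rewrite -ej.
      by rewrite (reprep (rep e) e) ?eqxx // crep.
    rewrite inE; apply: subset_trans sS; apply: subset_trans (bigcup_sup i iJ).
    by apply: subset_trans (sQ i); rewrite -ei subsetUr.
  apply: leq_ltn_trans (subset_leq_card sub) _; apply: leq_ltn_trans (leq_imset_card _ _) _.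
  by rewrite cD; move: le_q posq; clear; lia.
- rewrite -card_edge -(cardC [pred e | rep e != e]) addnC card_sig leq_add2r.
  rewrite -[X in _ <= X](card_ord k).
  have inj : {in [predC [pred e | rep e != e]] &, injective c}.
    move=> e e'; rewrite !inE !negbK => /eqP re /eqP re' /reprep.
    by rewrite re re'.
  by rewrite -(card_in_imset inj) max_card.
Qed.

End ColoringsAndUnits.

(** * Hexagons *)

(** A unit pair consists of six points [0, ..., 5] and the units [{0, 1, 2, 3}] and
    [{0, 1, 4, 5}]. Its points receive labels [xlab] modulo 23, [ylab] and [zlab]. *)
Definition xlab j := nth 0 [:: 0; 1; 3; 17; 5; 13] j.
Definition ylab j := nth 0 [:: 2; 3; 0; 1; 0; 1] j.
Definition zlab j := nth 0 [:: 2; 3; 0; 1; 1; 0] j.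

(** The pairs contained in a unit are those whose labels differ in both [ylab] and
    [zlab]; the four remaining pairs are the sides of a rectangle. *)
Definition adj6 j k := (ylab j != ylab k) && (zlab j != zlab k).

(** The 22 oriented adjacent pairs have distinct differences modulo 23, so that every
    nonzero residue is the difference of exactly one of them. *)
Lemma xlab_graceful j k j' k' : j < 6 -> k < 6 -> j' < 6 -> k' < 6 ->
  adj6 j k -> adj6 j' k' -> xlab j + xlab k' = xlab k + xlab j' %[mod 23] ->
  j = j' /\ k = k'.
Proof.
move=> ltj ltk ltj' ltk' jk jk' e.
pose s := iota 0 6.
have : all (fun j => all (fun k => all (fun j' => all (fun k' =>
  [&& adj6 j k, adj6 j' k' & xlab j + xlab k' == xlab k + xlab j' %[mod 23]] ==>
  (j == j') && (k == k')) s) s) s) s by vm_compute.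
have mem i : i < 6 -> i \in s by rewrite mem_iota.
move=> /allP/(_ j (mem j ltj))/allP/(_ k (mem k ltk))/allP/(_ j' (mem j' ltj')).
move=> /allP/(_ k' (mem k' ltk')); rewrite jk jk' e eqxx /= => /andP[/eqP-> /eqP->].
by [].
Qed.

(** Copies [pt p] of the six-point configuration in which an adjacent pair of one copy
    is no pair, adjacent or not, of another copy. *)
Section HexagonPacking.

Variables (n : nat) (P : finType) (pt : P -> nat -> 'I_n).
Hypothesis pt_inj : forall p j k, j < 6 -> k < 6 -> pt p j = pt p k -> j = k.
Hypothesis pt_adj : forall p p' j k j' k', j < 6 -> k < 6 -> j' < 6 -> k' < 6 ->
  adj6 j k -> pt p j = pt p' j' -> pt p k = pt p' k' -> [/\ p = p', j = j' & k = k'].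

Let pts p s : {set 'I_n} := [set x in map (pt p) s].

Let card_pts p s : uniq s -> all (fun j => j < 6) s -> #|pts p s| = size s.
Proof.
move=> us /allP s6; rewrite cardsE (card_uniqP _) ?size_map // map_inj_in_uniq //.
by move=> j k /s6 j6 /s6 k6; apply: pt_inj.
Qed.

Let corners (b : bool) := if b then [:: 0; 4; 1; 5] else [:: 0; 2; 1; 3].
Let U (i : P * bool) := pts i.1 (corners i.2).

Let cardU i : #|U i| = 4.
Proof. by rewrite /U; case: i.2; rewrite card_pts. Qed.

Let shareU i p s : i.1 != p -> all (fun j => j < 6) s -> #|U i :&: pts p s| <= 1.
Proof.
move=> np /allP s6; rewrite leqNgt; apply/negP => /card_gt1P[x [y []]].
rewrite !inE => /andP[/mapP[j jU ->] /mapP[j' js ej]] /andP[/mapP[k kU ->] /mapP[k' ks ek]].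
move=> nxy; have njk : j != k by apply: contra_neq nxy => ->.
have [] // : [/\ i.1 = p, j = j' & k = k'].
  have c6 : all (fun j => j < 6) (corners i.2) by case: i.2.
  apply: (pt_adj _ _ (s6 _ js) (s6 _ ks) _ ej ek); rewrite ?(allP c6) //.
  move: jU kU njk; rewrite /corners.
  by case: i.2; rewrite !inE => /or4P[]/eqP-> /or4P[]/eqP->.
by move=> e; rewrite e eqxx in np.
Qed.

(** Two units of one copy span its six points, and a third unit adds at least three. *)
Let U3 i j k : i != j -> k != i -> k != j -> i.1 = j.1 -> 8 < #|U i :|: U j :|: U k|.
Proof.
move=> nij nki nkj e1; have nb : i.2 != j.2.
  by apply: contraNneq nij => e2; rewrite [i]surjective_pairing e1 e2 -surjective_pairing.
have nk : k.1 != i.1.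
  apply/eqP => ek; have : (k.2 == i.2) || (k.2 == j.2).
    by move: nb; case: k.2; case: i.2; case: j.2.
  case/orP => /eqP e2.
    by case/eqP: nki; rewrite [k]surjective_pairing ek e2 -surjective_pairing.
  by case/eqP: nkj; rewrite [k]surjective_pairing ek e1 e2 -surjective_pairing.
have sub : pts i.1 (iota 0 6) \subset U i :|: U j.
  rewrite /U e1; apply/subsetP => x; rewrite in_setU /pts !in_set => /mapP[l l6 ->].
  move: nb l6; case: i.2; case: j.2 => // _; rewrite /= !inE -!orbA;
    by do 5?[case/orP => [/eqP->|]]; rewrite ?eqxx ?orbT // => /eqP->; rewrite ?eqxx ?orbT.
apply: leq_trans (subset_leq_card (setSU (U k) sub)).
rewrite cardsU cardU card_pts // setIC.
have := @shareU k i.1 (iota 0 6) nk isT; rewrite size_iota; clear; lia.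
Qed.

Let sparseU : sparse U 3 8 setT.
Proof.
move=> J _ cJ; have : uniq (enum J) by apply: enum_uniq.
have mem i : i \in enum J -> U i \subset hull U J.
  by rewrite mem_enum => iJ; apply: bigcup_sup.
move: mem; rewrite cardE in cJ; case: (enum J) cJ => [|i [|j [|k [|//]]]] //= _ mem.
rewrite !inE negb_or andbT => /andP[/andP[nij nik] njk].
have /subset_leq_card : U i :|: U j :|: U k \subset hull U J.
  by rewrite !subUset !mem // !inE eqxx ?orbT.
apply: leq_trans.
have [e|n1] := eqVneq i.1 j.1; first by apply: U3 => //; rewrite eq_sym.
have [e|n2] := eqVneq i.1 k.1.
  by rewrite -setUA [U j :|: _]setUC setUA; apply: U3 => //; rewrite eq_sym.
have [e|n3] := eqVneq j.1 k.1.
  by rewrite -setUA setUC; apply: U3.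
have c6 b : all (fun j => j < 6) (corners b) by case: b.
have := shareU n1 (c6 j.2); have := shareU n2 (c6 k.2); have := shareU n3 (c6 k.2).
rewrite -!/(U _) => s3 s2 s1.
have : #|(U i :|: U j) :&: U k| <= #|U i :&: U k| + #|U j :&: U k|.
  by rewrite setIUl leq_card_setU.
rewrite !cardsU !cardU; clear -s1 s2 s3; lia.
Qed.

Lemma gen_ramsey_le_hexagons : gen_ramsey n (isT : 26 <= 'C(8, 2)) + 2 * #|P| <= 'C(n, 2).
Proof.
(* The edges to be merged avoid the edge [{0, 1}] common to the two units. *)
pose e1 (i : P * bool) := [set pt i.1 0; pt i.1 (if i.2 then 4 else 2)].
pose e2 (i : P * bool) := [set pt i.1 1; pt i.1 (if i.2 then 5 else 3)].
have c1 i : #|e1 i| == 2.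
  rewrite cards2; apply/eqP; congr (_.+1); apply/eqP; rewrite eqb1.
  by apply/eqP => /pt_inj; case: i.2 => /(_ isT isT).
have c2 i : #|e2 i| == 2.
  rewrite cards2; apply/eqP; congr (_.+1); apply/eqP; rewrite eqb1.
  by apply/eqP => /pt_inj; case: i.2 => /(_ isT isT).
have set2I (x y x' y' : 'I_n) : [set x; y] = [set x'; y'] ->
    x = x' /\ y = y' \/ x = y' /\ y = x'.
  move=> e; have: x \in [set x'; y'] by rewrite -e set21.
  have: y \in [set x'; y'] by rewrite -e set22.
  have: x' \in [set x; y] by rewrite e set21.
  have: y' \in [set x; y] by rewrite e set22.
  by rewrite !inE; do 4![case/orP=> /eqP ?]; subst; auto.
have coin p p' j k j' k' : j < 6 -> k < 6 -> j' < 6 -> k' < 6 -> adj6 j k ->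
    [set pt p j; pt p k] = [set pt p' j'; pt p' k'] ->
    p = p' /\ (j = j' /\ k = k' \/ j = k' /\ k = j').
  move=> j6 k6 j6' k6' jk /set2I[] [ej ek].
    by have [-> -> ->] := pt_adj j6 k6 j6' k6' jk ej ek; auto.
  by have [-> -> ->] := pt_adj j6 k6 k6' j6' jk ej ek; auto.
have := @gen_ramsey_le_units n 8 26 2 isT (P * bool)%type
  (fun i => Sub (e1 i) (c1 i) : edge n) (fun i => Sub (e2 i) (c2 i) : edge n).
rewrite card_prod card_bool mulnC; apply => //.
- move=> [p b] [p' b'] /(congr1 val) /=; rewrite /e1 /=.
  by case: b b' => [] [] /coin[] // -> [] [].
- move=> [p b] [p' b'] /(congr1 val) /=; rewrite /e2 /=.
  by case: b b' => [] [] /coin[] // -> [] [].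
- move=> [p b] [p' b']; apply/eqP => /(congr1 val) /=; rewrite /e1 /e2 /=.
  by case: b b' => [] [] /coin[] // _ [] [].
- move=> J sJ cJ; apply: leq_trans (sparseU sJ cJ) _; rewrite subset_leq_card //.
  apply/bigcupsP => i iJ; apply: subset_trans (bigcup_sup i iJ) => /=.
  apply/subsetP => x; rewrite !inE /corners; case: i.2; rewrite /= !inE.
    by case/or4P => /eqP->; rewrite eqxx ?orbT.
  by case/or4P => /eqP->; rewrite eqxx ?orbT.
Qed.

End HexagonPacking.

(** * A packing of hexagons *)

Local Open Scope ring_scope.

(** No [u != 0] is killed by a positive integer less than [c]. *)
Definition torsion_free_below (G : zmodType) (c : nat) :=
  forall (u : G) d, (0 < d < c)%N -> u *+ d = 0 -> u = 0.

Section Lines.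

Variables (G : zmodType) (c : nat).
Hypothesis tfG : torsion_free_below G c.
Implicit Types u v : G.

Lemma mulrn_inj_below u j k : (j < c)%N -> (k < c)%N -> u *+ j = u *+ k -> j != k -> u = 0.
Proof.
wlog jk : j k / (j < k)%N => [hw ltj ltk e njk|].
  have [jk|kj|ejk] := ltngtP j k; first exact: (hw j k).
    by apply: (hw k j) => //; rewrite eq_sym.
  by rewrite ejk eqxx in njk.
move=> _ ltk e _; apply: (@tfG u (k - j)%N); first by move: jk ltk; lia.
by rewrite mulrnBr ?(ltnW jk) // e subrr.
Qed.

Lemma line_eq u v u' v' j k : (j < c)%N -> (k < c)%N -> j != k ->
  u *+ j + v = u' *+ j + v' -> u *+ k + v = u' *+ k + v' -> u = u' /\ v = v'.
Proof.
move=> ltj ltk njk ej ek.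
have eu : u = u'.
  apply/eqP; rewrite -subr_eq0; apply/eqP/(@mulrn_inj_below _ j k) => //.
  rewrite !mulrnBl; apply: (addIr (v - v')).
  move/eqP: ej; rewrite -subr_eq0 opprD addrACA => /eqP ej.
  move/eqP: ek; rewrite -subr_eq0 opprD addrACA => /eqP ek.
  by rewrite ej ek.
by split=> //; move: ej; rewrite eu => /addrI.
Qed.

Lemma line_neq u v j k : (j < c)%N -> (k < c)%N -> u != 0 ->
  (u *+ j + v == u *+ k + v) = (j == k).
Proof.
move=> ltj ltk u0; apply/eqP/eqP => [/addIr e|->] //; apply/eqP.
by apply: contraNT u0 => njk; rewrite (mulrn_inj_below ltj ltk e njk).
Qed.

End Lines.

Lemma Zp_torsion_free q c : (1 < q)%N -> (forall d, (0 < d < c)%N -> coprime q d) ->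
  torsion_free_below 'Z_q c.
Proof.
move=> q1 cop u d /cop cqd; rewrite -mulr_natr => /eqP; rewrite mulIr_eq0 => [/eqP //|].
by apply/mulIr; rewrite unitZpE.
Qed.

Section LeadingCoefficient.

Variables (F : finFieldType) (D : nat).
Implicit Types a : 'rV[F]_D.

(** Some nonzero coordinate of [a], whose position depends only on the support of [a];
    [0] if [a = 0]. *)
Definition lead a : F := if [pick i | a 0 i != 0] is Some i then a 0 i else 0.

Lemma leadZ x a : lead (x *: a) = x * lead a.
Proof.
have [->|x0] := eqVneq x 0.
  by rewrite mul0r /lead; case: pickP => // i; rewrite !mxE mul0r eqxx.
rewrite /lead (@eq_pick _ _ (fun i => a 0 i != 0)) => [|i].
  by case: pickP => [i _|_]; rewrite ?mxE ?mulr0.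
by rewrite mxE mulf_eq0 negb_or x0.
Qed.

Lemma lead_eq0 a : (lead a == 0) = (a == 0).
Proof.
apply/eqP/eqP => [|->].
  rewrite /lead; case: pickP => [i /eqP|a0 _] //.
  by apply/rowP => i; rewrite mxE; apply/eqP/negPn; rewrite a0.
by rewrite /lead; case: pickP => // i; rewrite mxE eqxx.
Qed.

(** By homogeneity the values of [lead] are equidistributed over the nonzero scalars. *)
Lemma card_lead1 : (#|F| ^ D <= #|F|.-1 * #|[pred a | lead a == 1%R]| + 1)%N.
Proof.
have -> : (#|F| ^ D = #|{: 'rV[F]_D}|)%N by rewrite card_mx mul1n.
rewrite -sum1_card (partition_big lead xpredT) //= (bigD1 0) //= addnC leq_add //.
  rewrite -(cardC1 (0 : F)) -sum_nat_const; apply: leq_sum => x x0.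
  rewrite sum1_card -(@card_in_imset _ _ (fun a => x^-1 *: a) [pred a | lead a == x]).
    apply/subset_leq_card/subsetP => _ /imsetP[a aX ->].
    by move: aX; rewrite !inE leadZ => /eqP->; rewrite mulVf.
  by move=> a b _ _ /(scalerI (_ : x^-1 != 0)); apply; rewrite invr_eq0.
rewrite sum1_card -[X in (_ <= X)%N](card1 (0 : 'rV[F]_D)).
apply/subset_leq_card/subsetP => a; rewrite [a \in pred1 _]inE -lead_eq0.
exact.
Qed.

End LeadingCoefficient.

Section Hexagons.

Variables (D q : nat).
Hypotheses (q1 : (1 < q)%N) (q6 : coprime q 6).

Local Notation X := 'rV['F_23]_D.
Local Notation Y := 'Z_q.

(** Six points on an affine line in each of the three coordinates. The direction in
    the first coordinate is normalized by [lead a = 1], so that a difference vector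
    determines, through [lead], the oriented pair of labels it comes from. *)
Definition hexagon : finType :=
  ({a : X | lead a == 1} * X * ({a : X | a != 0} * X) * ({s : Y | s != 0} * Y))%type.

Definition hexagon_point (p : hexagon) (j : nat) : X * X * Y :=
  (val p.1.1.1 *+ xlab j + p.1.1.2, val p.1.2.1 *+ zlab j + p.1.2.2,
   val p.2.1 *+ ylab j + p.2.2).

Lemma F23_torsion_free : torsion_free_below X 23.
Proof.
move=> u d /andP[d0 d23]; rewrite -scaler_nat => /eqP; rewrite scaler_eq0 => /orP[|/eqP //].
by move=> /eqP/(congr1 val); rewrite /= val_Fp_nat //= modn_small // => d00; rewrite d00 in d0.
Qed.

Lemma Y_torsion_free : torsion_free_below Y 4.
Proof.
apply: Zp_torsion_free => // d; case: d => [|[|[|[|]]]] // _.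
- exact: coprimen1.
- by apply: coprime_dvdr q6.
- by apply: coprime_dvdr q6.
Qed.

Lemma xlab_lt j : (xlab j < 23)%N.
Proof. by case: j => [|[|[|[|[|[|j]]]]]] //; rewrite /xlab nth_default. Qed.

Lemma ylab_lt j : (ylab j < 4)%N.
Proof. by case: j => [|[|[|[|[|[|j]]]]]] //; rewrite /ylab nth_default. Qed.

Lemma zlab_lt j : (zlab j < 23)%N.
Proof. by case: j => [|[|[|[|[|[|j]]]]]] //; rewrite /zlab nth_default. Qed.

Lemma xlab_inj j k : (j < 6)%N -> (k < 6)%N -> xlab j = xlab k -> j = k.
Proof.
case: j => [|[|[|[|[|[|j]]]]]] // _; by case: k => [|[|[|[|[|[|k]]]]]] // _.
Qed.

Lemma hexagon_point_inj p j k : (j < 6)%N -> (k < 6)%N ->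
  hexagon_point p j = hexagon_point p k -> j = k.
Proof.
move=> ltj ltk /(congr1 (fun t => t.1.1))/eqP /=.
rewrite (line_neq F23_torsion_free) ?xlab_lt //; last first.
  by rewrite -lead_eq0 (eqP (valP p.1.1.1)) oner_eq0.
by move/eqP; apply: xlab_inj.
Qed.

Lemma hexagon_point_adj p p' j k j' k' :
    (j < 6)%N -> (k < 6)%N -> (j' < 6)%N -> (k' < 6)%N -> adj6 j k ->
    hexagon_point p j = hexagon_point p' j' -> hexagon_point p k = hexagon_point p' k' ->
  [/\ p = p', j = j' & k = k'].
Proof.
move=> ltj ltk ltj' ltk' /andP[yjk zjk] ej ek.
have /= xj := congr1 (fun t => t.1.1) ej; have /= xk := congr1 (fun t => t.1.1) ek.
have /= zj := congr1 (fun t => t.1.2) ej; have /= zk := congr1 (fun t => t.1.2) ek.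
have /= yj := congr1 snd ej; have /= yk := congr1 snd ek.
have yjk' : ylab j' != ylab k'.
  apply: contraNneq yjk => e.
  by rewrite -(line_neq Y_torsion_free p.2.2 (ylab_lt j) (ylab_lt k) (valP p.2.1)) yj yk e.
have zjk' : zlab j' != zlab k'.
  apply: contraNneq zjk => e.
  rewrite -(line_neq F23_torsion_free p.1.2.2 (zlab_lt j) (zlab_lt k) (valP p.1.2.1)).
  by rewrite zj zk e.
(* Both pairs are adjacent; [lead] of their common difference identifies the labels. *)
have [ejj ekk] : j = j' /\ k = k'.
  apply: xlab_graceful; rewrite // ?/adj6 ?yjk ?yjk' //.
  have : ((xlab j)%:R - (xlab k)%:R) *: val p.1.1.1 =
         ((xlab j')%:R - (xlab k')%:R) *: val p'.1.1.1.
    rewrite !scalerBl !scaler_nat.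
    have := congr2 (fun u v => u - v) xj xk.
    by rewrite /= !opprD ![_ + (- _ - _)]addrACA !subrr !addr0.
  move/(congr1 (@lead _ _)); rewrite !leadZ (eqP (valP p.1.1.1)) (eqP (valP p'.1.1.1)) !mulr1.
  move/eqP; rewrite subr_eq addrAC eq_sym subr_eq -!natrD eq_sym => /eqP.
  move/(congr1 (@nat_of_ord _)); rewrite !val_Fp_nat // => ->.
  by rewrite [(xlab j' + _)%N]addnC.
subst j' k'.
have xjk : xlab j != xlab k.
  by apply: contraNneq yjk => /xlab_inj->.
have [ea eb] := line_eq F23_torsion_free (xlab_lt j) (xlab_lt k) xjk xj xk.
have [ea' eb'] := line_eq F23_torsion_free (zlab_lt j) (zlab_lt k) zjk zj zk.
have [es er] := line_eq Y_torsion_free (ylab_lt j) (ylab_lt k) yjk yj yk.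
split=> //; move: p p' {ej ek yj zj xj yk zk xk} ea eb ea' eb' es er.
move=> [[[a b] [a' b']] [s r]] [[[a1 b1] [a1' b1']] [s1 r1]] /=.
by move=> ea -> ea' -> es ->; congr (_, _, (_, _), (_, _)); exact: val_inj.
Qed.

Lemma card_neq (T : finType) (x : T) : #|[pred y | y != x]| = (#|T| - 1)%N.
Proof. by rewrite subn1 -(cardC1 x); apply: eq_card. Qed.

Lemma card_hexagon :
  (((23 ^ D - 1) * 23 ^ D) ^ 2 * ((q - 1) * q) <= 22 * #|hexagon|)%N.
Proof.
have cX : #|{: X}| = (23 ^ D)%N by rewrite card_mx card_ord mul1n.
have cY : #|{: Y}| = q by rewrite card_ord Zp_cast.
rewrite /hexagon !card_prod !card_sig cX cY.
have -> : #|[pred a : X | a != 0]| = (23 ^ D - 1)%N.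
  by have := @card_neq X 0; rewrite cX.
have -> : #|[pred s : Y | s != 0]| = (q - 1)%N.
  by have := @card_neq Y 0; rewrite cY.
have := card_lead1 'F_23 D; rewrite card_ord.
move: #|[pred a | _]| => N; rewrite Fp_cast //=.
move: (23 ^ D)%N ((q - 1) * q)%N => m w; rewrite addnC -leq_subLR => mN.
have -> : (((m - 1) * m) ^ 2 * w = (m - 1) * (m * ((m - 1) * m) * w))%N.
  by rewrite -mulnn; lia.
apply: leq_trans (leq_mul mN (leqnn _)) _.
by rewrite !mulnA.
Qed.

End Hexagons.

Lemma gen_ramsey_8_26_upper D q n : (1 < q)%N -> coprime q 6 -> ((23 ^ D) ^ 2 * q <= n)%N ->
  (11 * gen_ramsey n (isT : 26 <= 'C(8, 2)) + ((23 ^ D - 1) * 23 ^ D) ^ 2 * ((q - 1) * q)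
     <= 11 * 'C(n, 2))%N.
Proof.
move=> q1 q6 len; pose V := ('rV['F_23]_D * 'rV['F_23]_D * 'Z_q)%type.
have leV : (#|{: V}| <= n)%N.
  rewrite !card_prod card_mx !card_ord (Zp_cast q1) mul1n.
  by move: len; rewrite -mulnn.
pose g (v : V) := widen_ord leV (enum_rank v).
have inj_g : injective g.
  by move=> v w /(congr1 val) /= /val_inj/enum_rank_inj.
have le_hex : (gen_ramsey n (isT : 26 <= 'C(8, 2)) + 2 * #|hexagon D q| <= 'C(n, 2))%N.
  apply: (@gen_ramsey_le_hexagons n _ (fun p j => g (hexagon_point p j))).
    by move=> p j k ltj ltk /inj_g; apply: hexagon_point_inj.
  move=> p p' j k j' k' ltj ltk ltj' ltk' jk /inj_g ej /inj_g ek.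
  exact: (hexagon_point_adj q1 q6 ltj ltk ltj' ltk' jk ej ek).
move: (card_hexagon D q1) le_hex; move: 'C(n, 2) (gen_ramsey _ _) #|_| => a b c.
by move: ((_ ^ 2) * _)%N => d; lia.
Qed.

Local Close Scope ring_scope.

(** * Quadrilateral-free systems *)

Section QuadFree.

Variable T : finType.
Implicit Types (A B C E : {set T}) (F : {set {set T}}).

(** Four sets form a quadrilateral when any two of them meet and no three of them
    have a common point; such sets are automatically distinct. *)
Definition quad A B C E :=
  [/\ A :&: B != set0, A :&: C != set0, A :&: E != set0,
      B :&: C != set0 & B :&: E != set0] /\
  [/\ C :&: E != set0, A :&: B :&: C = set0, A :&: B :&: E = set0,
      A :&: C :&: E = set0 & B :&: C :&: E = set0].

Lemma quadC12 A B C E : quad A B C E -> quad B A C E.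
Proof. by case=> -[? ? ? ? ?] [? ? ? ? ?]; do 2?split; by rewrite // [B :&: A]setIC. Qed.

Lemma quadC23 A B C E : quad A B C E -> quad A C B E.
Proof.
case=> -[? ? ? ? ?] [? ? ? ? ?]; do 2?split; by rewrite // ?[C :&: B]setIC // setIAC.
Qed.

Lemma quadC34 A B C E : quad A B C E -> quad A B E C.
Proof.
case=> -[? ? ? ? ?] [? ? ? ? ?]; do 2?split; by rewrite // ?[E :&: C]setIC // setIAC.
Qed.

(** A partial Steiner system of blocks of size 4 without quadrilaterals. *)
Definition quad_free F :=
  [/\ forall B, B \in F -> #|B| = 4,
      {in F &, forall B C, B != C -> #|B :&: C| <= 1}
    & {in F & F, forall A B, {in F & F, forall C E, ~ quad A B C E}}].

(** Four blocks with pairwise intersections of size at most one span at least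
    16 - 6 = 10 points, with equality only for quadrilaterals. *)
Lemma quad_free_sparse F : quad_free F ->
  sparse (fun B : {B | B \in F} => val B) 4 10 setT.
Proof.
case=> c4 lin qf J _ cJ; have : uniq (enum J) by apply: enum_uniq.
have mem i : i \in enum J -> val i \subset hull (fun B : {B | B \in F} => val B) J.
  by rewrite mem_enum => iJ; apply: (bigcup_sup i iJ).
move: mem; rewrite cardE in cJ.
case: (enum J) cJ => [|i [|j [|k [|l [|//]]]]] //= _ mem.
rewrite !inE !negb_or !andbT => /and3P[/and3P[nij nik nil] /andP[njk njl] nkl].
have sub : val i :|: val j :|: val k :|: val l
    \subset hull (fun B : {B | B \in F} => val B) J.
  by rewrite !subUset !mem // !inE eqxx ?orbT.
apply: leq_trans (subset_leq_card sub); rewrite ltnNge; apply/negP => le10.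
have lin2 (x y : {B | B \in F}) : x != y -> #|val x :&: val y| <= 1.
  by move=> nxy; apply: lin (valP x) (valP y) _.
have card4 (x : {B | B \in F}) : #|val x| = 4 by apply: c4 (valP x).
apply: (qf _ _ (valP i) (valP j) _ _ (valP k) (valP l)).
move: le10 (lin2 _ _ nij) (lin2 _ _ nik) (lin2 _ _ nil)
  (lin2 _ _ njk) (lin2 _ _ njl) (lin2 _ _ nkl).
have := (card4 i, card4 j, card4 k, card4 l).
move: (val i) (val j) (val k) (val l) => A B C E.
move=> [[[cA cB] cC] cE].
have e3 : #|A :&: C :|: B :&: C| = #|A :&: C| + #|B :&: C| - #|A :&: B :&: C|.
  by rewrite cardsU setIACA setIid.
have e4 : #|A :&: E :|: B :&: E| = #|A :&: E| + #|B :&: E| - #|A :&: B :&: E|.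
  by rewrite cardsU setIACA setIid.
have e5 : #|(A :&: C :|: B :&: C) :&: E| = #|A :&: C :&: E :|: B :&: C :&: E|.
  by rewrite !setIUl.
have e6 : #|(A :|: B :|: C) :&: E| =
    #|A :&: E :|: B :&: E| + #|C :&: E| - #|(A :|: B) :&: C :&: E|.
  by rewrite setIUl cardsU setIACA setIid [(A :|: B) :&: E]setIUl.
have e7 : #|A :&: B :&: C| <= #|A :&: B| by rewrite subset_leq_card ?subsetIl.
have e8 : #|A :&: B :&: E| <= #|A :&: B| by rewrite subset_leq_card ?subsetIl.
rewrite cardsU e6 e4 cardsU setIUl e3 cardsU cA cB cC cE => le10 l1 l2 l3 l4 l5 l6.
have {}e5 : #|A :&: C :&: E :|: B :&: C :&: E| = 0.
  rewrite -e5; clear -le10 l1 l2 l3 l4 l5 l6; lia.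
move/eqP: e5; rewrite cards_eq0 setU_eq0 => /andP[/eqP ace /eqP bce].
split; split=> //; rewrite -?card_gt0; try (apply/eqP; rewrite -cards_eq0);
  clear -le10 l1 l2 l3 l4 l5 l6; lia.
Qed.

End QuadFree.

(** * Lines across four layers *)

Local Open Scope ring_scope.

Section FourLayers.

Variables (R : finComUnitRingType) (t : 'I_4 -> R).
Hypothesis unit_t : forall i j, i != j -> t i - t j \is a GRing.unit.
Hypothesis unit_2 : (2%:R : R) \is a GRing.unit.
Hypothesis unit_harm : forall p q r s, uniq [:: p; q; r; s] ->
  (t r - t p) * (t s - t q) + (t s - t r) * (t q - t p) \is a GRing.unit.

Implicit Types (B : {set R}) (p : R * R) (i j k l : 'I_4).

(** The points are the pairs [(i, x)] of a layer [i] and an [x] in [R]. The line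
    [p = (a, b)] has one point in each layer [i], at height [t i * a + b]. *)
Definition height i p := t i * p.1 + p.2.
Definition line p : {set 'I_4 * R} := [set (i, height i p) | i : 'I_4].
Definition layer i B : {set 'I_4 * R} := [set (i, x) | x in B].

Lemma mem_line i x p : ((i, x) \in line p) = (x == height i p).
Proof.
apply/imsetP/eqP => [[j _ [-> ->]]|->] //; by exists i.
Qed.

Lemma mem_layer i x j B : ((i, x) \in layer j B) = (i == j) && (x \in B).
Proof.
apply/imsetP/andP => [[y yB [-> ->]]|[/eqP-> xB]] //; by exists x.
Qed.

Lemma card_line p : #|line p| = 4%N.
Proof. by rewrite card_imset ?card_ord // => i j []. Qed.

Lemma card_layer i B : #|layer i B| = #|B|.
Proof. by rewrite card_imset // => x y []. Qed.

Lemma layer_inj i : injective (layer i).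
Proof.
by move=> B C e; apply/setP => x; have := mem_layer i x i B; rewrite e mem_layer eqxx.
Qed.

Lemma layerI i B C : layer i B :&: layer i C = layer i (B :&: C).
Proof.
by apply/setP => -[j x]; rewrite inE !mem_layer inE; case: (j == i).
Qed.

Lemma layer0 i : layer i set0 = set0.
Proof. by rewrite /layer imset0. Qed.

Lemma height_inj i j p p' : i != j -> height i p = height i p' ->
  height j p = height j p' -> p = p'.
Proof.
case: p p' => [a b] [a' b'] nij; rewrite /height /= => ei ej.
have ea : a = a'.
  apply/(mulrI (unit_t nij)); rewrite !mulrBl.
  have -> : t i * a - t j * a = (t i * a + b) - (t j * a + b) by ring.
  by rewrite ei ej; ring.
by move: ei; rewrite ea => /addrI ->.
Qed.

Lemma line_meet p p' : line p :&: line p' != set0 -> exists i, height i p = height i p'.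
Proof.
case/set0Pn => -[i x]; rewrite inE !mem_line => /andP[/eqP-> /eqP].
by exists i.
Qed.

Lemma card_lineI p p' : p != p' -> (#|line p :&: line p'| <= 1)%N.
Proof.
move=> npp'; rewrite leqNgt; apply/negP => /card_gt1P[[i x] [[j y] []]].
rewrite !inE !mem_line => /andP[/eqP-> /eqP ei] /andP[/eqP-> /eqP ej] nxy.
case/eqP: npp'; apply: (@height_inj i j) => //.
by apply: contraNneq nxy => ->.
Qed.

Lemma line_inj : injective line.
Proof.
move=> p p' e; apply/eqP/negPn/negP => /card_lineI.
by rewrite e setIid card_line.
Qed.

Lemma card_line_layer p i B : (#|line p :&: layer i B| <= 1)%N.
Proof.
rewrite leqNgt; apply/negP => /card_gt1P[[j x] [[k y] []]].
rewrite !inE !mem_line !mem_layer => /andP[/eqP-> /andP[/eqP-> _]].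
by move=> /andP[/eqP-> /andP[/eqP-> _]]; rewrite eqxx.
Qed.

(** Three lines that meet pairwise without a common point do so in distinct layers. *)
Lemma three_lines i j k p1 p2 p3 : line p1 :&: line p2 :&: line p3 = set0 ->
    height i p1 = height i p2 -> height j p1 = height j p3 ->
    height k p2 = height k p3 ->
  [/\ i != j, i != k & j != k].
Proof.
move=> e e12 e13 e23.
have no m : height m p1 = height m p2 -> height m p1 = height m p3 -> False.
  move=> h12 h13; have : (m, height m p1) \in line p1 :&: line p2 :&: line p3.
    by rewrite !inE !mem_line -h12 -h13 !eqxx.
  by rewrite e inE.
split; apply/eqP => eij; subst.
- exact: (no j).
- by apply: (no k); rewrite ?e12.
- by apply: (no k); rewrite ?e13 ?e23.
Qed.

Lemma fourth_index i j k : i != j -> i != k -> j != k -> exists2 l : 'I_4,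
  uniq [:: i; j; k; l] & forall m, m \in [:: i; j; k; l].
Proof.
move=> nij nik njk.
have [l lijk] : exists l, l \notin [:: i; j; k].
  apply/existsP; rewrite -negb_forall; apply/negP => /forallP all3.
  have : (#|'I_4| <= size [:: i; j; k])%N.
    by apply: leq_trans (card_size _); apply/subset_leq_card/subsetP => x _; apply: all3.
  by rewrite card_ord.
have u : uniq [:: i; j; k; l].
  by move: lijk; rewrite /= !inE !negb_or nij nik njk ![l == _]eq_sym => /and3P[-> -> ->].
exists l => // m; have /card_uniqP c4 := u.
have /subset_cardP c : #|[:: i; j; k; l]| = #|'I_4| by rewrite c4 card_ord.
have /c -> // : [:: i; j; k; l] \subset 'I_4 by apply/subsetP.
Qed.

(** The layers of the six crossings of four lines form a proper edge coloring of [K_4]: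
    opposite crossings may share a layer, adjacent ones may not. Since the first
    three layers are distinct, at most one further layer [s] is used, which leaves
    four cases; in each of them the linear system for the coefficients [p.1] is nonsingular. *)
Lemma no_quad_lines p1 p2 p3 p4 : ~ quad (line p1) (line p2) (line p3) (line p4).
Proof.
case=> -[/line_meet[i12 e12] /line_meet[i13 e13] /line_meet[i14 e14] /line_meet[i23 e23]].
move=> /line_meet[i24 e24] [/line_meet[i34 e34] t123 t124 t134 t234].
have [n1213 n1223 n1323] := three_lines t123 e12 e13 e23.
have [n1214 n1224 n1424] := three_lines t124 e12 e14 e24.
have [n1314 n1334 n1434] := three_lines t134 e13 e14 e34.
have [n2324 n2334 n2434] := three_lines t234 e23 e24 e34.
have [s us mem4] := fourth_index n1213 n1214 n1314.
have ut i j : i != j -> t i - t j \is a GRing.unit by apply: unit_t.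
(* The determinant of the three equations for the differences of the coefficients [p.1]. *)
pose det := (t i24 - t i14) * (t i23 - t i12) * (t i34 - t i13) -
            (t i34 - t i14) * (t i23 - t i13) * (t i24 - t i12).
have unit_det : det \is a GRing.unit.
  have o34 : i34 = i12 \/ i34 = s.
    by move: (mem4 i34); rewrite !inE [i34 == i13]eq_sym [i34 == i14]eq_sym
      (negPf n1334) (negPf n1434) /= => /orP[]/eqP->; auto.
  have o24 : i24 = i13 \/ i24 = s.
    by move: (mem4 i24); rewrite !inE [i24 == i12]eq_sym [i24 == i14]eq_sym
      (negPf n1224) (negPf n1424) /= => /orP[]/eqP->; auto.
  have o23 : i23 = i14 \/ i23 = s.
    by move: (mem4 i23); rewrite !inE [i23 == i12]eq_sym [i23 == i13]eq_sym
      (negPf n1223) (negPf n1323) /= => /orP[]/eqP->; auto.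
  have uh a b c d : perm_eq [:: a; b; c; d] [:: i12; i13; i14; s] ->
      (t c - t a) * (t d - t b) + (t d - t c) * (t b - t a) \is a GRing.unit.
    by move=> ab; apply: unit_harm; rewrite (perm_uniq ab).
  rewrite /det.
  case: o34 => e; subst i34; case: o24 => e; subst i24; case: o23 => e; subst i23;
    rewrite ?eqxx // in n2324 n2334 n2434.
  - have -> : forall x y z : R, (y - z) * (z - x) * (x - y) - (x - z) * (z - y) * (y - x) =
      2%:R * (y - z) * (z - x) * (x - y) by move=> *; ring.
    by rewrite !unitrM unit_2 !ut // eq_sym.
  - have -> : forall x y z w : R, (y - z) * (w - x) * (x - y) - (x - z) * (w - y) * (y - x) =
      (x - y) * ((w - x) * (y - z) + (y - w) * (z - x)) by move=> *; ring.
    rewrite unitrM ut //= (uh i12 i14 s i13) //.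
    by apply/permP => f /=; clear; lia.
  - have -> : forall x y z w : R, (w - z) * (z - x) * (x - y) - (x - z) * (z - y) * (w - x) =
      (z - x) * ((z - y) * (w - x) + (w - z) * (x - y)) by move=> *; ring.
    rewrite unitrM ut 1?eq_sym //= (uh i13 i12 i14 s) //.
    by apply/permP => f /=; clear; lia.
  - have -> : forall x y z w : R, (y - z) * (z - x) * (w - y) - (w - z) * (z - y) * (y - x) =
      (y - z) * ((z - x) * (w - y) + (w - z) * (y - x)) by move=> *; ring.
    rewrite unitrM ut //= (uh i12 i13 i14 s) //.
suff e14' : p1 = p4.
  by have [] := three_lines t124 e12 (congr1 (height i12) e14') e24; rewrite eqxx.
have a14 : p1.1 = p4.1.
  have chase i j k (p p' p'' : R * R) : height i p = height i p' ->
      height j p = height j p'' -> height k p' = height k p'' ->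
      (p'.1 - p.1) * (t k - t i) = (p''.1 - p.1) * (t k - t j).
    rewrite /height => ei ej ek; apply/eqP; rewrite -subr_eq0; apply/eqP.
    have -> : (p'.1 - p.1) * (t k - t i) - (p''.1 - p.1) * (t k - t j) =
      (t k * p'.1 + p'.2 - (t k * p''.1 + p''.2)) + (t i * p.1 + p.2 - (t i * p'.1 + p'.2)) -
      (t j * p.1 + p.2 - (t j * p''.1 + p''.2)) by ring.
    by rewrite ei ej ek !subrr addr0 subr0.
  have c23 := chase _ _ _ _ _ _ e12 e13 e23.
  have c24 := chase _ _ _ _ _ _ e12 e14 e24.
  have c34 := chase _ _ _ _ _ _ e13 e14 e34.
  apply/eqP; rewrite eq_sym -subr_eq0; apply/eqP/(mulIr unit_det); rewrite mul0r /det mulrBr.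
  rewrite !mulrA -c24 -c34.
  have -> : forall x y z w v u : R, x * y * z * w - u * w * v * y = y * w * (x * z - u * v).
    by move=> *; ring.
  by rewrite c23 subrr mulr0.
case: p1 p4 a14 e14 {e12 e13 e34 e24 t123 t124 t134 t234} => [a1 b1] [a4 b4] /= <-.
by rewrite /height /= => /addrI ->.
Qed.

(** The relation satisfied by the heights [x], [y], [z] in layer [i] of three lines that
    cross pairwise in the layers [j], [k] and [l]. *)
Definition aligned i j k l (x y z : R) :=
  (x - y) * ((t j - t k) * (t i - t l)) == (y - z) * ((t k - t l) * (t i - t j)).

(** The block [B], placed in a layer, may form a quadrilateral with three lines. *)
Definition has_aligned B := [exists w : 'I_4 * 'I_4 * 'I_4 * 'I_4, exists v : R * R * R,
  let: (i, j, k, l) := w in let: (x, y, z) := v in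
  [&& uniq [:: i; j; k; l], uniq [:: x; y; z], x \in B, y \in B, z \in B
    & aligned i j k l x y z]].

Lemma no_quad_layer_lines i B p1 p2 p3 :
  ~~ has_aligned B -> ~ quad (layer i B) (line p1) (line p2) (line p3).
Proof.
move=> good [].
have atB p : layer i B :&: line p != set0 -> height i p \in B.
  by case/set0Pn => -[j x]; rewrite inE mem_layer mem_line => /andP[/andP[/eqP-> xB] /eqP <-].
move=> [/atB h1 /atB h2 /atB h3 /line_meet[j e12] /line_meet[k e13]].
move=> [/line_meet[l e23] t12 t13 t23 t123].
have nh p p' : layer i B :&: line p :&: line p' = set0 -> height i p \in B ->
    height i p != height i p'.
  move=> e hB; apply/eqP => eh; have : (i, height i p) \in layer i B :&: line p :&: line p'.
    by rewrite !inE mem_layer !mem_line -eh !eqxx hB.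
  by rewrite e inE.
have n12 := nh _ _ t12 h1; have n13 := nh _ _ t13 h1; have n23 := nh _ _ t23 h2.
have [njk njl nkl] := three_lines t123 e12 e13 e23.
case/negP: good; apply/existsP; exists (i, j, k, l); apply/existsP.
exists (height i p1, height i p2, height i p3).
have nij : i != j by apply: contra_neq n12 => ->.
have nik : i != k by apply: contra_neq n13 => ->.
have nil : i != l by apply: contra_neq n23 => ->.
rewrite h1 h2 h3 /= !inE !negb_or nij nik nil njk njl nkl n12 n13 n23 /=.
rewrite /aligned /height -subr_eq0.
move: e12 e13 e23; rewrite /height => e12 e13 e23.
pose u := p1.1 - p2.1; pose v := p2.1 - p3.1.
have d12 : t j * u = p2.2 - p1.2.
  have -> : t j * u = (t j * p1.1 + p1.2) - (t j * p2.1 + p2.2) + (p2.2 - p1.2).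
    by rewrite /u; ring.
  by rewrite e12 subrr add0r.
have d23 : t l * v = p3.2 - p2.2.
  have -> : t l * v = (t l * p2.1 + p2.2) - (t l * p3.1 + p3.2) + (p3.2 - p2.2).
    by rewrite /v; ring.
  by rewrite e23 subrr add0r.
have uv : u * (t j - t k) = v * (t k - t l).
  apply/eqP; rewrite -subr_eq0; apply/eqP.
  have -> : u * (t j - t k) - v * (t k - t l) = t j * u + t l * v - t k * (u + v) by ring.
  rewrite d12 d23.
  have -> : p2.2 - p1.2 + (p3.2 - p2.2) - t k * (u + v) =
    (t k * p3.1 + p3.2) - (t k * p1.1 + p1.2) by rewrite /u /v; ring.
  by rewrite e13 subrr.
have -> : t i * p1.1 + p1.2 - (t i * p2.1 + p2.2) = t i * u - (p2.2 - p1.2).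
  by rewrite /u; ring.
have -> : t i * p2.1 + p2.2 - (t i * p3.1 + p3.2) = t i * v - (p3.2 - p2.2).
  by rewrite /v; ring.
rewrite -d12 -d23.
have -> : (t i * u - t j * u) * ((t j - t k) * (t i - t l)) -
    (t i * v - t l * v) * ((t k - t l) * (t i - t j)) =
  (u * (t j - t k) - v * (t k - t l)) * ((t i - t j) * (t i - t l)) by ring.
by rewrite uv subrr mul0r.
Qed.

Variable F : {set {set R}}.
Hypothesis qfF : quad_free F.

(** All lines, and in each layer a copy of the admissible blocks of [F]. *)
Definition four_layers : {set {set 'I_4 * R}} :=
  [set line p | p : R * R] :|:
  [set layer w.1 w.2 | w in setX [set: 'I_4] [set B in F | ~~ has_aligned B]].

Lemma four_layersP (X : {set 'I_4 * R}) : X \in four_layers ->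
  (exists p, X = line p) \/ (exists i B, [/\ B \in F, ~~ has_aligned B & X = layer i B]).
Proof.
rewrite inE => /orP[/imsetP[p _ ->]|/imsetP[[i B]]]; first by left; exists p.
by rewrite !inE /= => /andP[BF gB] ->; right; exists i, B; split.
Qed.

(** If two of the four sets lie in layers, a line meeting both would contain their
    common point; so all four sets lie in the same layer. *)
Lemma no_quad_two_layers i j B C X Y : B \in F -> C \in F ->
  X \in four_layers -> Y \in four_layers -> ~ quad (layer i B) (layer j C) X Y.
Proof.
move=> BF CF /four_layersP XF /four_layersP YF q; have [_ _ qf] := qfF.
have eji : j = i.
  case: q => -[/set0Pn[[k x]]]; rewrite inE !mem_layer.
  by move=> /andP[/andP[/eqP<- _] /andP[/eqP-> _]].
subst j.
have same Z W :
    (exists p, Z = line p) \/ (exists k E, [/\ E \in F, ~~ has_aligned E & Z = layer k E]) ->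
    quad (layer i B) (layer i C) Z W -> exists2 E, E \in F & Z = layer i E.
  case=> [[p ->]|[k [E [EF _ ->]]]] [] [_ /set0Pn[[m x] +] _ /set0Pn[[m' x'] +] _].
    rewrite !inE !mem_layer !mem_line => /andP[/andP[/eqP-> xB] /eqP ex].
    move=> /andP[/andP[/eqP-> xC] /eqP ex'] [_ /setP/(_ (i, height i p))].
    by rewrite !inE !mem_layer mem_line !eqxx -{1}ex xB -ex' xC.
  rewrite !inE !mem_layer => /andP[/andP[/eqP-> _] /andP[/eqP<- _]] _ _.
  by exists E.
have [E EF eX] := same X Y XF q.
have [E' EF' eY] := same Y X YF (quadC34 q).
move: q; rewrite eX eY => -[[q1 q2 q3 q4 q5] [q6 q7 q8 q9 q10]].
apply: (qf B C BF CF E E' EF EF').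
have ne (U V : {set R}) : layer i U :&: layer i V != set0 -> U :&: V != set0.
  by apply: contra_neq => e; rewrite layerI e layer0.
have em (U V W : {set R}) : layer i U :&: layer i V :&: layer i W = set0 -> U :&: V :&: W = set0.
  by rewrite !layerI -(layer0 i) => /layer_inj.
by do 2!split; try exact: ne; exact: em.
Qed.

Lemma four_layers_quad_free : quad_free four_layers.
Proof.
have [c4 lin qf] := qfF.
split.
- move=> X /four_layersP[[p ->]|[i [B [BF _ ->]]]]; first exact: card_line.
  by rewrite card_layer c4.
- move=> X Y /four_layersP[[p ->]|[i [B [BF _ ->]]]] 
    /four_layersP[[p' ->]|[i' [B' [BF' _ ->]]]] nXY.
  + by apply: card_lineI; apply: contra_neq nXY => ->.
  + exact: card_line_layer.
  + by rewrite setIC; apply: card_line_layer.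
  + have [ei|ni] := eqVneq i i'; last first.
      rewrite [X in #|pred_of_set X|](_ : _ = set0) ?cards0 //.
      apply/setP => -[j x]; rewrite !inE !mem_layer; apply/negP => /andP[/andP[/eqP-> _]].
      by rewrite (negPf ni).
    subst i'; rewrite layerI card_layer; apply: lin => //.
    by apply: contra_neq nXY => ->.
- move=> X1 X2 h1 h2 X3 X4 h3 h4 q.
  have := four_layersP h1; have := four_layersP h2.
  have := four_layersP h3; have := four_layersP h4.
  case=> [[p4 e4]|[i4 [B4 [BF4 g4 e4]]]] [[p3 e3]|[i3 [B3 [BF3 g3 e3]]]]
    [[p2 e2]|[i2 [B2 [BF2 g2 e2]]]] [[p1 e1]|[i1 [B1 [BF1 g1 e1]]]]; subst.
  + exact: (no_quad_lines q).
  + exact: (no_quad_layer_lines g1 q).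
  + exact: (no_quad_layer_lines g2 (quadC12 q)).
  + exact: (no_quad_two_layers BF1 BF2 h3 h4 q).
  + exact: (no_quad_layer_lines g3 (quadC12 (quadC23 q))).
  + exact: (no_quad_two_layers BF1 BF3 h2 h4 (quadC23 q)).
  + exact: (no_quad_two_layers BF2 BF3 h1 h4 (quadC23 (quadC12 q))).
  + exact: (no_quad_two_layers BF1 BF2 h3 h4 q).
  + exact: (no_quad_layer_lines g4 (quadC12 (quadC23 (quadC34 q)))).
  + exact: (no_quad_two_layers BF1 BF4 h2 h3 (quadC23 (quadC34 q))).
  + exact: (no_quad_two_layers BF2 BF4 h1 h3 (quadC23 (quadC34 (quadC12 q)))).
  + exact: (no_quad_two_layers BF1 BF2 h3 h4 q).
  + exact: (no_quad_two_layers BF3 BF4 h1 h2 (quadC23 (quadC34 (quadC12 (quadC23 q))))).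
  + exact: (no_quad_two_layers BF1 BF3 h2 h4 (quadC23 q)).
  + exact: (no_quad_two_layers BF2 BF3 h1 h4 (quadC23 (quadC12 q))).
  + exact: (no_quad_two_layers BF1 BF2 h3 h4 q).
Qed.

Lemma card_four_layers :
  #|four_layers| = (#|R| ^ 2 + 4 * #|[set B in F | ~~ has_aligned B]|)%N.
Proof.
rewrite /four_layers cardsU card_imset ?card_prod; last exact: line_inj.
rewrite card_in_imset; last first.
  move=> [i B] [j C]; rewrite !inE /= => /andP[BF _] /andP[CF _] e.
  have [c4 _ _] := qfF.
  have eij : i = j.
    have /card_gt0P[x xB] : (0 < #|B|)%N by rewrite c4.
    by have := mem_layer i x i B; rewrite e mem_layer eqxx xB => /andP[/eqP].
  by move: e; rewrite eij => /layer_inj->.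
rewrite cardsX cardsT card_ord mulnn.
rewrite [X in (_ - #|pred_of_set X|)%N](_ : _ = set0) ?cards0 ?subn0 //.
apply/setP => X; rewrite !inE; apply/negP => /andP[/imsetP[p _ ->] /imsetP[[i B] _ e]].
have := card_line_layer p i B; rewrite -e setIid card_line.
by [].
Qed.

End FourLayers.

(** * The choice of the slopes *)

(** The four slopes. The parameter [m] is left free, so as to avoid the aligned triples
    of most blocks of a given system. *)
Definition slope (m : nat) (i : 'I_4) : int := nth 0 [:: 0; 1; 3; m%:Z] i.

Lemma slope_neq m i j : (3 < m)%N -> i != j -> slope m i - slope m j != 0.
Proof.
case: i => [[|[|[|[|//]]]] ?]; case: j => [[|[|[|[|//]]]] ?]; rewrite /slope //=; lia.
Qed.

Lemma slope_le m i : (3 < m)%N -> 0 <= slope m i <= m%:Z.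
Proof. by case: i => [[|[|[|[|//]]]] ?]; rewrite /slope /=; lia. Qed.

(** No ordering of the four slopes is harmonic. *)
Lemma slope_harm m p q r s : (3 < m)%N -> uniq [:: p; q; r; s] ->
  (slope m r - slope m p) * (slope m s - slope m q) +
  (slope m s - slope m r) * (slope m q - slope m p) != 0.
Proof.
move=> m3.
case: p => [[|[|[|[|//]]]] ?]; case: q => [[|[|[|[|//]]]] ?] //;
case: r => [[|[|[|[|//]]]] ?]; rewrite /= ?inE //=;
case: s => [[|[|[|[|//]]]] ?]; rewrite //= /slope /= => _; lia.
Qed.

(** Two parameters give non-proportional coefficients in the alignment condition. *)
Lemma slope_det m m' i j k l : uniq [:: i; j; k; l] ->
  `|(slope m j - slope m k) * (slope m i - slope m l) *
    ((slope m' k - slope m' l) * (slope m' i - slope m' j)) -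
    (slope m' j - slope m' k) * (slope m' i - slope m' l) *
    ((slope m k - slope m l) * (slope m i - slope m j))| = `|6 * (m%:Z - m'%:Z)|.
Proof.
case: i => [[|[|[|[|//]]]] ?]; case: j => [[|[|[|[|//]]]] ?] //;
case: k => [[|[|[|[|//]]]] ?]; rewrite /= ?inE //=;
case: l => [[|[|[|[|//]]]] ?]; rewrite //= /slope /= => _; lia.
Qed.

(** Every integer whose invertibility is needed is at most [3 * (K + 4) ^ 2] in
    absolute value, and so is invertible modulo [q] unless it is zero. *)
Section ChooseSlope.

Variables (q K : nat).
Hypothesis q1 : (1 < q)%N.
Hypothesis cop_q : forall d, (0 < d <= 3 * (K + 4) ^ 2)%N -> coprime q d.

Lemma intr_unit (z : int) : z != 0 -> (`|z| <= 3 * (K + 4) ^ 2)%N ->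
  (z%:~R : 'Z_q) \is a GRing.unit.
Proof.
have unit_nat n : (0 < n <= 3 * (K + 4) ^ 2)%N -> (n%:R : 'Z_q) \is a GRing.unit.
  by move=> /cop_q; rewrite unitZpE.
case: z => [n n0 le|n _ le]; first by rewrite -pmulrn unit_nat // lt0n n0.
by rewrite NegzE rmorphN unitrN /= -pmulrn unit_nat.
Qed.

Definition dir (m : nat) (i : 'I_4) : 'Z_q := (slope m i)%:~R.

Section OneSlope.

Variable m : nat.
Hypothesis m_range : (3 < m <= K + 4)%N.

Let m3 : (3 < m)%N. Proof. by case/andP: m_range. Qed.

Let slope_le_K i : 0 <= slope m i <= (K + 4)%:Z.
Proof.
have := slope_le i m3; have := m_range; lia.
Qed.

Lemma dir_unit i j : i != j -> dir m i - dir m j \is a GRing.unit.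
Proof.
move=> nij; rewrite /dir -rmorphB; apply: intr_unit; first exact: slope_neq.
have := slope_le_K i; have := slope_le_K j; move: (slope m i) (slope m j) => a b.
by move: (K + 4)%N => n; nia.
Qed.

Lemma dir_harm p r s t : uniq [:: p; r; s; t] ->
  (dir m s - dir m p) * (dir m t - dir m r) + (dir m t - dir m s) * (dir m r - dir m p)
    \is a GRing.unit.
Proof.
move=> u; rewrite /dir -!rmorphB -!rmorphM -rmorphD; apply: intr_unit; first exact: slope_harm.
have := slope_le_K p; have := slope_le_K r; have := slope_le_K s; have := slope_le_K t.
move: (slope m p) (slope m r) (slope m s) (slope m t) => a b c d.
move: (K + 4)%N => n ld lc lb la.
have h1 : `|(c - a) * (d - b)| <= n%:Z * n%:Z.
  by rewrite normrM ler_pM ?normr_ge0 //; lia.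
have h2 : `|(d - c) * (b - a)| <= n%:Z * n%:Z.
  by rewrite normrM ler_pM ?normr_ge0 //; lia.
have : `|(c - a) * (d - b) + (d - c) * (b - a)| <= n%:Z * n%:Z + n%:Z * n%:Z.
  by apply: le_trans (ler_normD _ _) (lerD h1 h2).
by rewrite -mulnn; lia.
Qed.

End OneSlope.

Lemma unit2_q : (2%:R : 'Z_q) \is a GRing.unit.
Proof. by rewrite unitZpE // cop_q //; have : (16 <= (K + 4) ^ 2)%N; [rewrite -mulnn; nia|lia]. Qed.

(** Three given points are aligned, in given layers, for at most one parameter. *)
Lemma aligned_slope_inj m m' (i j k l : 'I_4) (x y z : 'Z_q) : (m <= K + 4)%N -> (m' <= K + 4)%N ->
  uniq [:: i; j; k; l] -> x != y ->
  aligned (dir m) i j k l x y z -> aligned (dir m') i j k l x y z -> m = m'.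
Proof.
move=> mK m'K u nxy /eqP e /eqP e'; apply/eqP; apply: contraNT nxy => nm.
rewrite /dir in e e'; rewrite -!rmorphB -!rmorphM /= in e e'.
set a := (slope m j - _) * _ in e; set b := (slope m k - _) * _ in e.
set a' := (slope m' j - _) * _ in e'; set b' := (slope m' k - _) * _ in e'.
have det := slope_det m m' u; rewrite -/a -/b -/a' -/b' in det.
have d0 : a * b' - a' * b != 0.
  by rewrite -normr_gt0 det normr_gt0; lia.
have dK : (absz (a * b' - a' * b)%R <= 3 * (K + 4) ^ 2)%N.
  have : `|6 * (m%:Z - m'%:Z)| <= 6 * (K + 4)%:Z by lia.
  rewrite -det -mulnn; move: (a * b' - a' * b : int) => w; clear; nia.
have un := intr_unit d0 dK; clearbody a b a' b'.
rewrite -subr_eq0 -(mulIr_eq0 _ (mulIr un)) rmorphB !rmorphM /= mulrBr.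
by rewrite !mulrA e e' mulrAC subrr.
Qed.

(** [4 ^ 4] choices of layers and [4 ^ 3] choices of points. *)
Lemma card_aligned_slopes (B : {set 'Z_q}) : #|B| = 4%N ->
  (#|[set m : 'I_K | has_aligned (dir (m + 4)) B]| <= 4 ^ 7)%N.
Proof.
move=> cB.
pose good (m : 'I_K) (u : 'I_4 * 'I_4 * 'I_4 * 'I_4 * ('Z_q * 'Z_q * 'Z_q)) :=
  let: (i, j, k, l, (x, y, z)) := u in
  [&& uniq [:: i; j; k; l], uniq [:: x; y; z], x \in B, y \in B, z \in B
    & aligned (dir (m + 4)) i j k l x y z].
pose f m := [pick u | good m u].
pose D := [set Some u | u in setX [set: 'I_4 * 'I_4 * 'I_4 * 'I_4] (setX (setX B B) B)].
have cD : #|D| = (4 ^ 7)%N.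
  rewrite card_imset; last by move=> ? ? [].
  by rewrite !cardsX cB cardsT !card_prod !card_ord.
have fP m : m \in [set m : 'I_K | has_aligned (dir (m + 4)) B] ->
    exists2 u, f m = Some u & good m u.
  rewrite inE => /existsP[w /existsP[v wv]]; rewrite /f; case: pickP => [u gu|]; first by exists u.
  by move=> /(_ (w, v)); rewrite /good; case: w wv => [[[i j] k] l]; case: v => [[x y] z] ->.
rewrite -cD -(@card_in_imset _ _ f).
  apply/subset_leq_card/subsetP => _ /imsetP[m /fP[u fu gu] ->]; rewrite fu.
  apply/imsetP; exists u => //; move: gu; rewrite /good.
  case: u {fu} => [[[[i j] k] l] [[x y] z]] /and5P[_ _ xB yB /andP[zB _]].
  by rewrite !inE /= xB yB zB.
move=> m m' /fP[u fu gu] /fP[u' fu' gu'] ff; move: gu'.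
have <- : u = u' by move: ff; rewrite fu fu' => -[].
move: gu; rewrite /good; case: u {fu ff} => [[[[i j] k] l] [[x y] z]].
move=> /and5P[uw uv _ _ /andP[_ s]] /and5P[_ _ _ _ /andP[_ s']].
have nxy : x != y by move: uv; rewrite /= !inE negb_or => /andP[/andP[]].
apply/val_inj/(@addIn 4)/(aligned_slope_inj _ _ uw nxy s s').
  by rewrite leq_add2r ltnW.
by rewrite leq_add2r ltnW.
Qed.

(** By averaging, some parameter spoils only a small proportion of the blocks. *)
Lemma exists_slope (F : {set {set 'Z_q}}) : (0 < K)%N -> quad_free F ->
  exists2 m, (3 < m <= K + 4)%N &
    (K * #|[set B in F | has_aligned (dir m) B]| <= 4 ^ 7 * #|F|)%N.
Proof.
move=> K0 [c4 _ _].
have [/existsP[m hm]|] := boolP [exists m : 'I_K,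
    (K * #|[set B in F | has_aligned (dir (m + 4)) B]| <= 4 ^ 7 * #|F|)%N].
  by exists (m + 4)%N => //; rewrite addn4 /= -addn4 leq_add2r ltnW.
rewrite negb_exists => /forallP big.
have : (\sum_(m < K) #|[set B in F | has_aligned (dir (m + 4)) B]| <= 4 ^ 7 * #|F|)%N.
  have -> : (\sum_(m < K) #|[set B in F | has_aligned (dir (m + 4)) B]| =
      \sum_(B in F) #|[set m : 'I_K | has_aligned (dir (m + 4)) B]|)%N.
    rewrite (@exchange_card _ _ 'I_K F (fun m B => has_aligned (dir (m + 4)) B)).
    by apply: eq_bigr => B _; apply: eq_card => m; rewrite !inE.
  rewrite mulnC -sum_nat_const; apply: leq_sum => B BF.
  by apply: card_aligned_slopes; apply: c4.
move=> le; have : (\sum_(m < K) (4 ^ 7 * #|F|).+1 <=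
    \sum_(m < K) K * #|[set B in F | has_aligned (dir (m + 4)) B]|)%N.
  by apply: leq_sum => m _; have := big m; rewrite -ltnNge.
rewrite sum_nat_const card_ord -big_distrr /= leq_pmul2l // => lt.
by have := leq_trans lt le; rewrite ltnn.
Qed.

(** A system on [q] points yields one on [4 * q] points, with [q ^ 2] lines and almost
    four copies of the given system. *)
Lemma four_layers_exist (F : {set {set 'Z_q}}) : (0 < K)%N -> quad_free F ->
  exists2 G : {set {set 'I_4 * 'Z_q}}, quad_free G &
    (K * (q ^ 2 + 4 * #|F|) <= K * #|G| + 4 ^ 8 * #|F|)%N.
Proof.
move=> K0 qF; have [m mK le] := exists_slope K0 qF.
exists (four_layers (dir m) F).
  apply: four_layers_quad_free => //.
  - exact: dir_unit.
  - exact: unit2_q.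
  - exact: dir_harm.
rewrite card_four_layers //; last exact: dir_unit.
have : #|F| =
    (#|[set B in F | has_aligned (dir m) B]| + #|[set B in F | ~~ has_aligned (dir m) B]|)%N.
  rewrite -(cardsID [set B | has_aligned (dir m) B] F); congr (_ + _)%N.
    by apply: eq_card => B; rewrite !inE.
  by apply: eq_card => B; rewrite !inE andbC.
move: le; move: #|F| #|[set B in F | has_aligned _ B]| #|[set B in F | ~~ _]| => a b c.
have -> : #|'Z_q| = q by rewrite card_ord Zp_cast.
move: (q ^ 2)%N (4 ^ 7)%N (expnS 4 7) => r w -> le ea.
have -> : (K * (r + 4 * a) = K * (r + 4 * c) + 4 * (K * b))%N by rewrite ea; lia.
by rewrite leq_add2l -mulnA leq_mul2l le orbT.
Qed.

End ChooseSlope.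

(** * Dense quadrilateral-free systems *)

(** Quadrilateral-freeness is preserved by an injective renaming of the points. *)
Lemma quad_free_imset (T T' : finType) (g : T -> T') (F : {set {set T}}) :
  injective g -> quad_free F -> quad_free [set g @: (B : {set T}) | B in F].
Proof.
move=> gI [c4 lin qf]; have gII : injective (fun B : {set T} => g @: B) by apply: imset_inj.
have im (B C : {set T}) : g @: B :&: g @: C = g @: (B :&: C).
  by rewrite imsetI // => x y _ _; apply: gI.
split.
- by move=> _ /imsetP[B BF ->]; rewrite card_imset // c4.
- move=> _ _ /imsetP[B BF ->] /imsetP[C CF ->] nBC; rewrite im card_imset //.
  by apply: lin => //; apply: contra_neq nBC => ->.
- move=> _ _ /imsetP[B BF ->] /imsetP[C CF ->] _ _ /imsetP[D DF ->] /imsetP[E EF ->].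
  case=> -[q1 q2 q3 q4 q5] [q6 q7 q8 q9 q10]; apply: (qf B C BF CF D E DF EF).
  have ne (U V : {set T}) : g @: U :&: g @: V != set0 -> U :&: V != set0.
    by apply: contra_neq => e; rewrite im e imset0.
  have em (U V W : {set T}) : g @: U :&: g @: V :&: g @: W = set0 -> U :&: V :&: W = set0.
    by rewrite !im => /eqP; rewrite imset_eq0 => /eqP.
  by do 2!split; try exact: ne; exact: em.
Qed.

(** Asymptotically, all but a proportion [e] of the pairs of points can be covered by
    the blocks of a quadrilateral-free system. *)
Definition quad_free_deficit (R : archiRealFieldType) (e : R) := forall d : R, 0 < d ->
  exists N, forall n, (N <= n)%N -> exists2 F : {set {set 'I_n}}, quad_free F &
    (1 - e - d) * n%:R ^+ 2 <= 12 * #|F|%:R.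

Lemma quad_free_card_le (T : finType) (F : {set {set T}}) : (1 < #|T|)%N ->
  quad_free F -> (#|F| <= #|T| ^ 2)%N.
Proof.
move=> T1 qF; have [c4 _ _] := qF.
have := sparse_4_10_bound (fun B : {B | B \in F} => c4 _ (valP B)) (quad_free_sparse qF).
have -> : #|{: {B | B \in F}}| = #|F| by rewrite card_sig; apply: eq_card.
by rewrite -mulnn; move: #|F| #|T| T1 => f t t1; nia.
Qed.

Lemma quad_free_deficit1 (R : archiRealFieldType) : quad_free_deficit (1 : R).
Proof.
move=> d d0; exists 0%N => n _; exists set0.
  by split=> [B|B C|A B]; rewrite inE.
by rewrite cards0 mulr0 subrr sub0r mulNr oppr_le0 mulr_ge0 ?sqr_ge0 // ltW.
Qed.

(** The largest [q = 1] modulo [L] with [a * q <= n]. *)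
Lemma div_window a n L : (0 < L)%N -> (0 < a <= n)%N ->
  exists s, (a * (L * s + 1) <= n < a * (L * s + 1) + a * L)%N.
Proof.
move=> L0 /andP[a0 an]; exists ((n - a) %/ (a * L))%N.
have lt : ((n - a) %% (a * L) < a * L)%N by rewrite ltn_pmod // muln_gt0 a0.
have eq := divn_eq (n - a) (a * L).
have -> : (a * (L * ((n - a) %/ (a * L)) + 1) = (n - a) %/ (a * L) * (a * L) + a)%N.
  by rewrite mulnDr muln1 mulnA mulnC.
by move: lt eq an; set r := (_ %% _)%N; set s := (_ %/ _)%N; clearbody r s; clear; nia.
Qed.

(** The estimate for the deficit of a system of [g] blocks on [y] points obtained from one
    of [f] blocks on [x] points, where [y] is close to [4 * x] and [k] is large. *)
Lemma deficit_arith (R : realFieldType) (e d k x y f g C w : R) :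
  0 <= e <= 1 -> 0 < d -> 0 < k -> 0 <= g ->
  0 <= x -> C <= y -> 0 <= C -> 4 * x <= y -> y <= 4 * x + C ->
  0 <= w -> 64 * w <= k * d -> 8 * C <= d * y -> f <= x ^+ 2 -> 0 <= f ->
  (1 - e - d) * x ^+ 2 <= 12 * f ->
  k * (x ^+ 2 + 4 * f) <= k * g + w * f ->
  (1 - e / 4 - d) * y ^+ 2 <= 12 * g.
Proof.
move=> /andP[e0 e1] d0 k0 g0 x0 Cy C0 xy yx w0 kd Cd fx f0 xf kf.
have [neg|pos] := lerP (1 - e / 4 - d) 0.
  by apply: (@le_trans _ _ 0); [rewrite mulr_le0_ge0 ?sqr_ge0|rewrite mulr_ge0].
have fd : w * f * 64 <= k * (d * x ^+ 2).
  have h1 : 64 * w * f <= k * d * x ^+ 2 by apply: ler_pM => //; rewrite mulr_ge0.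
  by rewrite mulrA; apply: le_trans h1; rewrite -[_ * 64]mulrC mulrA.
have kx : 0 <= k * (d * x ^+ 2) by rewrite !mulr_ge0 ?sqr_ge0 // ltW.
have h2 : 16 * x ^+ 2 * (1 - e / 4 - 5 * d / 16) <= 12 * g.
  rewrite -(ler_pM2l k0).
  have kf' : k * ((1 - e - d) * x ^+ 2) <= k * (12 * f) by rewrite ler_pM2l.
  lra.
have h3 : y ^+ 2 - 2 * C * y <= 16 * x ^+ 2.
  have : (y - C) ^+ 2 <= (4 * x) ^+ 2 by rewrite ler_sqr ?nnegrE; lra.
  rewrite !expr2; nra.
have h4 : 8 * C * y <= d * y * y by rewrite ler_wpM2r //; lra.
apply: le_trans h2.
have p1 : 0 <= 1 - e / 4 - 5 * d / 16 by lra.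
have h5 := ler_wpM2r p1 h3.
apply: le_trans h5.
have Cy0 : 0 <= C * y by rewrite mulr_ge0 //; lra.
have h6 : C * y * (1 - e / 4 - 5 * d / 16) <= C * y * 1 by rewrite ler_wpM2l //; lra.
have y2 : 0 <= d * (y * y) by rewrite mulr_ge0 ?(ltW d0) // mulr_ge0 //; lra.
rewrite !expr2; lra.
Qed.

(** The lines cover all pairs of points in distinct layers, i.e. three quarters of all
    pairs; the deficit only comes from within the layers. *)
Lemma quad_free_deficit_step (R : archiRealFieldType) (e : R) :
  0 <= e <= 1 -> quad_free_deficit e -> quad_free_deficit (e / 4).
Proof.
move=> e01 de d d0.
have [w layers] : exists w : nat, forall q K, (1 < q)%N ->
    (forall d, (0 < d <= 3 * (K + 4) ^ 2)%N -> coprime q d) ->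
    forall F : {set {set 'Z_q}}, (0 < K)%N -> quad_free F ->
    exists2 G : {set {set 'I_4 * 'Z_q}}, quad_free G &
      (K * (q ^ 2 + 4 * #|F|) <= K * #|G| + w * #|F|)%N.
  by exists (4 ^ 8)%N; exact: four_layers_exist.
have bound (x : R) : 0 <= x -> exists2 m, (0 < m)%N & x <= m%:R * d.
  move=> x0; exists (Num.bound (x / d)).+1 => //.
  have xd : 0 <= x / d by rewrite divr_ge0 // ltW.
  by rewrite -ler_pdivrMr // (le_trans (ltW (archi_boundP xd))) // ler_nat.
have [K K0 hK] := bound (64 * w%:R) (mulr_ge0 (ler0n _ _) (ler0n _ _)).
(* Any [q = 1] modulo a large factorial is coprime to all small integers. *)
have [L L0 cop] : exists2 L, (0 < L)%N &
    forall s k, (0 < k <= 3 * (K + 4) ^ 2)%N -> coprime (L * s + 1) k.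
  exists (3 * (K + 4) ^ 2)`!; first exact: fact_gt0.
  move=> s k /dvdn_fact kL; rewrite coprime_sym /coprime.
  have /dvdnP[z ->] : (k %| (3 * (K + 4) ^ 2)`! * s)%N by rewrite dvdn_mulr.
  by rewrite gcdnMDl gcdn1.
have [N hN] := de d d0; pose C := (4 * L)%N.
have [N1 _ hN1] := bound (8 * C%:R) (mulr_ge0 (ler0n _ _) (ler0n _ _)).
exists (4 * (N + 2) + C + N1)%N => n nN.
have n4 : (4 <= n)%N by move: nN; clear; lia.
have [s] := @div_window 4 n L L0 n4; set q := (L * s + 1)%N => /andP[qn nq].
have Nq : (N <= q)%N by move: nN nq; rewrite /C; clear; lia.
have q1 : (1 < q)%N by move: nN nq; rewrite /C; clear; lia.
have [|F qF hF] := hN (Zp_trunc q).+2; first by rewrite Zp_cast.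
have fq : (#|F| <= q ^ 2)%N.
  have cZ : #|'Z_q| = q by rewrite card_ord Zp_cast.
  by have := @quad_free_card_le 'Z_q F; rewrite cZ => /(_ q1 qF).
have [G qG hG] := layers q K q1 (cop s) F K0 qF.
have leV : (#|{: 'I_4 * 'Z_q}| <= n)%N by rewrite card_prod !card_ord Zp_cast // ltnW.
pose g (v : 'I_4 * 'Z_q) := widen_ord leV (enum_rank v).
have inj_g : injective g by move=> u v /(congr1 val) /= /val_inj/enum_rank_inj.
exists [set g @: (B : {set 'I_4 * 'Z_q}) | B in G]; first exact: quad_free_imset.
rewrite card_imset; last exact: imset_inj.
have zq : ((Zp_trunc q).+2%:R : R) = q%:R by rewrite Zp_cast.
rewrite zq in hF; rewrite -!(ler_nat R) in hG fq.
rewrite natrD !natrM natrD natrM natrX in hG; rewrite natrX in fq.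
move: #|F| #|G| {qF qG} hF hG fq => f g' hF hG fq.
have qnR : 4 * q%:R <= n%:R :> R by rewrite -natrM ler_nat.
have nqR : n%:R <= 4 * q%:R + C%:R :> R.
  by rewrite -natrM -natrD ler_nat; move: nq; rewrite /C; clear; lia.
have CnR : C%:R <= n%:R :> R by rewrite ler_nat; move: nN; clear; lia.
have CdR : 8 * C%:R <= d * n%:R :> R.
  apply: le_trans hN1 _; rewrite mulrC ler_wpM2l ?ler_nat ?ltW //.
  by move: nN; clear; lia.
have KR : 0 < K%:R :> R by rewrite ltr0n.
exact: (deficit_arith e01 d0 KR (ler0n _ _) (ler0n _ _) CnR (ler0n _ _) qnR nqR
  (ler0n _ _) hK CdR fq (ler0n _ _) hF hG).
Qed.

Lemma quad_free_dense (k : nat) : (0 < k)%N -> exists N, forall n, (N <= n)%N ->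
  exists2 F : {set {set 'I_n}}, quad_free F & ((k - 1) * n ^ 2 <= 12 * k * #|F|)%N.
Proof.
move=> k0.
have e4 j : 0 <= (4^-1 : rat) ^+ j <= 1.
  by elim: j => [|j /andP[h0 h1]]; rewrite ?expr0 // exprS; lra.
have deficit j : quad_free_deficit ((4^-1 : rat) ^+ j).
  elim: j => [|j IH]; first by rewrite expr0; apply: quad_free_deficit1.
  by rewrite exprSr; apply: quad_free_deficit_step.
have [j hj] : exists j, (4^-1 : rat) ^+ j * (2 * k)%:R <= 1.
  exists (2 * k)%N; elim: (2 * k)%N => [|j IH]; first by rewrite mulr0.
  rewrite exprS -[j.+1]addn1 natrD; have /andP[] := e4 j.
  by move: IH; move: (_ ^+ j) (j%:R) => p x h1 h2 h3; lra.
have k2 : 0 < ((2 * k)%:R : rat)^-1 by rewrite invr_gt0 ltr0n muln_gt0.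
have [N hN] := deficit j _ k2; exists N => n /hN[F qF hF]; exists F => //.
have kR : 0 < k%:R :> rat by rewrite ltr0n.
rewrite -(ler_nat rat) natrM natrX natrB // !natrM.
have kd : k%:R * ((2 * k)%:R)^-1 = 2^-1 :> rat.
  by rewrite natrM; field; rewrite (gt_eqF kR).
rewrite natrM in hj kd hF.
have hkF : k%:R * ((1 - 4^-1 ^+ j - (2 * k%:R)^-1) * n%:R ^+ 2) <= k%:R * (12 * #|F|%:R) :> rat.
  by rewrite ler_pM2l.
rewrite (mulrC 12) -mulrA; apply: le_trans hkF; rewrite mulrA ler_wpM2r ?sqr_ge0 //.
by move: hj kd; move: (4^-1 ^+ j) => e; set d := (_ * _)^-1; move: d (k%:R) => d x; lra.
Qed.

Local Close Scope ring_scope.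

(** * Bounds on the generalized Ramsey numbers *)

(** Merge two disjoint edges in each block. *)
Lemma gen_ramsey_le_quad_free n (F : {set {set 'I_n}}) : quad_free F ->
  gen_ramsey n (isT : 42 <= 'C(10, 2)) + #|F| <= 'C(n, 2).
Proof.
move=> qF; have [c4 lin _] := qF; pose I := {B | B \in F}.
have half (B : I) : exists A : {set 'I_n}, (A \subset val B) && (#|A| == 2).
  have : 0 < #|pairs (val B)| by rewrite card_pairs c4 ?(valP B).
  by case/card_gt0P => A; rewrite inE; exists A.
pose h1 B := xchoose (half B); pose h2 B := val B :\: h1 B.
have h1P B : (h1 B \subset val B) && (#|h1 B| == 2) by exact: xchooseP (half B).
have h2P B : #|h2 B| == 2.
  have /andP[s /eqP c] := h1P B.
  by rewrite /h2 cardsD (setIidPr s) c c4 ?(valP B).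
have share (B C : I) (A : {set 'I_n}) : #|A| == 2 -> A \subset val B -> A \subset val C -> B = C.
  move=> /eqP A2 sB sC; apply/val_inj/eqP/negPn/negP => nBC.
  have := lin _ _ (valP B) (valP C) nBC; apply/negP; rewrite -ltnNge -A2.
  by rewrite subset_leq_card // subsetI sB.
have s1 B : h1 B \subset val B by case/andP: (h1P B).
have s2 B : h2 B \subset val B by exact: subsetDl.
have c1 B : #|h1 B| == 2 by case/andP: (h1P B).
have <- : #|{: I}| = #|F| by rewrite card_sig; apply: eq_card.
apply: (@gen_ramsey_le_units n 10 42 3 isT _
  (fun B => Sub (h1 B) (c1 B) : edge n) (fun B => Sub (h2 B) (h2P B) : edge n)) => //.
- by move=> B C /(congr1 val) /= e; apply: (share _ _ (h1 B)) => //; rewrite e.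
- by move=> B C /(congr1 val) /= e; apply: (share _ _ (h2 B)) => //; rewrite e.
- move=> B C; apply/eqP => /(congr1 val) /= e.
  have eBC : B = C by apply: (share _ _ (h1 B)) => //; rewrite e.
  have : h1 B :&: h2 B == set0 by rewrite /h2 setIDA setIC -setIDA setDv setI0.
  by rewrite {2}eBC -e setIid -cards_eq0 (eqP (c1 B)).
- move=> J sJ cJ; have := quad_free_sparse qF sJ cJ.
  congr (_ < #|pred_of_set _|); apply: eq_bigr => B _ /=.
  by rewrite /h2 -[LHS](setID _ (h1 B)) (setIidPr (s1 B)).
Qed.

Lemma gen_ramsey_10_42_upper k : 0 < k -> exists N, forall n, N <= n ->
  12 * k * gen_ramsey n (isT : 42 <= 'C(10, 2)) <= (5 * k + 1) * n ^ 2.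
Proof.
move=> k0; have [N hN] := quad_free_dense k0; exists N => n /hN[F /gen_ramsey_le_quad_free].
move: (gen_ramsey _ _) #|F| (double_bin2 n) => f g; move: 'C(n, 2) => b e le hF.
have {}e : 2 * b <= n ^ 2 by rewrite e -mulnn leq_mul2l leq_pred orbT.
have le1 := leq_mul (leqnn (12 * k)) le.
have le2 := leq_mul (leqnn (6 * k)) e.
move: hF le1 le2; rewrite mulnBl mul1n; move: (n ^ 2) => w; nia.
Qed.

(** Hexagons over vectors of length [8 * k], with [q] the largest integer equal to [1]
    modulo 6 for which they fit in [n] vertices. *)
Lemma gen_ramsey_8_26_upper_asymp k : 0 < k -> exists N, forall n, N <= n ->
  22 * k * gen_ramsey n (isT : 26 <= 'C(8, 2)) <= (9 * k + 1) * n ^ 2.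
Proof.
move=> k0; pose m := 23 ^ (8 * k).
have m8 : 8 * k < m by apply: ltn_expl.
have m0 : 0 < m ^ 2 by rewrite expn_gt0; case: (m) m8.
exists (m ^ 2 * (52 * k)) => n nN.
have [|s /andP[le1 lt1]] := @div_window (m ^ 2) n 6 isT.
  by rewrite m0 (leq_trans _ nN) // leq_pmulr // muln_gt0 k0.
pose q := 6 * s + 1; rewrite -/q in le1 lt1.
have Qk : 52 * k < q + 6.
  by rewrite -(ltn_pmul2l m0) mulnDr; apply: leq_ltn_trans nN lt1.
have q1 : 1 < q by move: Qk k0; clear; lia.
have q6 : coprime q 6 by rewrite /q mulnC coprime_sym /coprime gcdnMDl gcdn1.
have := gen_ramsey_8_26_upper q1 q6 le1; rewrite -/m.
move: (gen_ramsey _ _) (double_bin2 n) => f; move: 'C(n, 2) => b e le.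
have {}e : 2 * b <= n ^ 2 by rewrite e -mulnn leq_mul2l leq_pred orbT.
pose w := ((m - 1) * m) ^ 2 * ((q - 1) * q); rewrite -/w in le.
suff hw : (2 * k - 1) * n ^ 2 <= 2 * k * w.
  have l1 := leq_mul (leqnn (2 * k)) le; have l2 := leq_mul (leqnn (11 * k)) e.
  by move: hw l1 l2; rewrite mulnBl mul1n; move: (n ^ 2) w {le} => y z; clear; nia.
pose Q := q + 6; rewrite -/Q in Qk.
have nQ : n ^ 2 <= (m ^ 2 * Q) ^ 2.
  by rewrite leq_exp2r // ltnW // /Q mulnDr.
apply: leq_trans (leq_mul (leqnn _) nQ) _.
have wQ : (m - 2) * m ^ 3 * ((Q - 13) * Q) <= w.
  have -> : (m - 2) * m ^ 3 = (m - 2) * m * m ^ 2 by rewrite (expnS m 2) mulnA.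
  rewrite /w expnMn; apply: leq_mul.
    by rewrite leq_mul2r -mulnn; apply/orP; right; move: (m) m8; clear; nia.
  by rewrite /Q; move: (q); clear; nia.
apply: leq_trans (leq_mul (leqnn _) wQ).
have -> : (2 * k - 1) * (m ^ 2 * Q) ^ 2 = (2 * k - 1) * (m * Q) * (m ^ 3 * Q).
  by rewrite expnMn -expnM !expnS !expn0; lia.
have -> : 2 * k * ((m - 2) * m ^ 3 * ((Q - 13) * Q)) = 2 * k * ((m - 2) * (Q - 13)) * (m ^ 3 * Q).
  lia.
rewrite leq_mul2r; apply/orP; right.
have [a em ak] : exists2 a, m = a + 2 & 8 * k <= a + 1.
  by exists (m - 2); move: (m) m8 k0; clear; lia.
have [c eQ ck] : exists2 c, Q = c + 13 & 52 * k <= c + 12.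
  by exists (Q - 13); move: (Q) Qk k0; clear; lia.
rewrite em eQ !addnK; have := leq_mul ak (leqnn c); have := leq_mul (leqnn a) ck.
by move: ak ck k0; clear; nia.
Qed.

Lemma gen_ramsey_8_26_lower n : 8 <= n ->
  9 * n ^ 2 <= 22 * gen_ramsey n (isT : 26 <= 'C(8, 2)) + 17 * n.
Proof.
move=> n8; have [|I [Q [c4 sp le]]] := @gen_ramsey_units n 8 26 isT; first by [].
have := sparse_3_8_bound c4 sp; have := double_bin2 n.
move: le; rewrite card_ord; move: 'C(n, 2) (gen_ramsey _ _) #|I| => b f i le e hI.
have : n ^ 2 = n * n.-1 + n by rewrite -mulnSr -mulnn; case: (n) n8.
move: e hI; move: (n ^ 2) (n * n.-1) => w v; lia.
Qed.

Lemma gen_ramsey_10_42_lower n : 10 <= n ->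
  5 * n ^ 2 <= 12 * gen_ramsey n (isT : 42 <= 'C(10, 2)) + 10 * n.
Proof.
move=> n10; have [|I [Q [c4 sp le]]] := @gen_ramsey_units n 10 42 isT; first by [].
have := sparse_4_10_bound c4 sp; have := double_bin2 n.
move: le; rewrite card_ord; move: 'C(n, 2) (gen_ramsey _ _) #|I| => b f i le e hI.
have : n ^ 2 = n * n.-1 + n by rewrite -mulnSr -mulnn; case: (n) n10.
move: e hI; move: (n ^ 2) (n * n.-1) => w v; lia.
Qed.

(** * Asymptotics *)

From mathcomp Require Import all_classical all_reals all_analysis.
Import Order.TTheory GRing.Theory Num.Theory.
Import numFieldNormedType.Exports.
Local Open Scope classical_set_scope.
Local Open Scope ring_scope.

Lemma quadratic_asymptotics (R : realType) (f : nat -> nat) (a b c m : nat) :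
    (0 < b)%N ->
    (forall k, (0 < k)%N -> exists N, forall n, (N <= n)%N ->
      (b * k * f n <= (a * k + 1) * n ^ 2)%N) ->
    (forall n, (m <= n)%N -> (a * n ^ 2 <= b * f n + c * n)%N) ->
  (fun n : nat => (f n)%:R : R^o) =
    (fun n : nat => a%:R / b%:R * n%:R ^+ 2 : R^o) +o_\oo (fun n : nat => n%:R ^+ 2 : R^o).
Proof.
move=> b0 up lo; apply/eqaddoP => e e0 /=.
have b1 : 1 <= b%:R :> R by rewrite ler1n.
have bR : 0 < b%:R :> R by rewrite ltr0n.
pose k := (Num.bound e^-1).+1.
have ke : 1 <= k%:R * e.
  have e0' : 0 <= e^-1 by rewrite invr_ge0 ltW.
  by rewrite -ler_pdivrMr // div1r (le_trans (ltW (archi_boundP e0'))) // ler_nat.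
have [N hN] := up k isT.
near=> n.
have mn : (m <= n)%N by near: n; apply: nbhs_infty_ge.
have Nn : (N <= n)%N by near: n; apply: nbhs_infty_ge.
have cn : (c * k <= n)%N by near: n; apply: nbhs_infty_ge.
have kR : 0 < k%:R :> R by rewrite ltr0n.
have n0 : 0 <= n%:R :> R by rewrite ler0n.
have := lo n mn; rewrite -(ler_nat R) natrM natrX natrD !natrM => {}lo.
have := hN n Nn; rewrite -(ler_nat R) [X in _ <= X]natrM natrX natrD !natrM => {}hN.
rewrite -(ler_nat R) natrM in cn.
rewrite [X in _ <= _ * X]ger0_norm ?sqr_ge0 //.
rewrite -[(_ - _) n]/((f n)%:R - a%:R / b%:R * n%:R ^+ 2).
rewrite -(ler_pM2l bR) -[X in X * `|_|](gtr0_norm bR) -normrM.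
have -> : b%:R * ((f n)%:R - a%:R / b%:R * n%:R ^+ 2) =
    b%:R * (f n)%:R - a%:R * n%:R ^+ 2 :> R.
  by rewrite mulrBr !mulrA [b%:R * a%:R]mulrC mulfK // gt_eqF.
have n2 : 0 <= n%:R ^+ 2 :> R by apply: sqr_ge0.
have sq : n%:R ^+ 2 <= k%:R * (e * n%:R ^+ 2) :> R by rewrite mulrA ler_peMl.
have le_be : e * n%:R ^+ 2 <= b%:R * (e * n%:R ^+ 2) by rewrite ler_peMl // mulr_ge0 // ltW.
apply: le_trans le_be; rewrite ler_norml; apply/andP; split.
  have h : c%:R * n%:R <= e * n%:R ^+ 2.
    have h1 : k%:R * (c%:R * n%:R) <= n%:R ^+ 2 :> R.
      by rewrite mulrA expr2 ler_wpM2r // mulrC.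
    by rewrite -(ler_pM2l kR); apply: le_trans h1 sq.
  lra.
rewrite -(ler_pM2l kR); apply: le_trans sq; lra.
Unshelve. all: by end_near.
Qed.

Theorem theorem2 (R : realType) :
  ((fun n : nat => (@gen_ramsey n 8 26 isT)%:R : R^o) =
     (fun n : nat => 9 / 22 * n%:R ^+ 2 : R^o)
       +o_\oo (fun n : nat => n%:R ^+ 2 : R^o)) /\
  ((fun n : nat => (@gen_ramsey n 10 42 isT)%:R : R^o) =
     (fun n : nat => 5 / 12 * n%:R ^+ 2 : R^o)
       +o_\oo (fun n : nat => n%:R ^+ 2 : R^o)).
Proof.
split.
  apply: (@quadratic_asymptotics R (fun n => @gen_ramsey n 8 26 isT) 9 22 17 8) => //.
    exact: gen_ramsey_8_26_upper_asymp.
  exact: gen_ramsey_8_26_lower.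
apply: (@quadratic_asymptotics R (fun n => @gen_ramsey n 10 42 isT) 5 12 10 10) => //.
  exact: gen_ramsey_10_42_upper.
exact: gen_ramsey_10_42_lower.
Qed.
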